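(* In the setting described in the context (splitting type FB or DR, $\gamma\in(0,1/L)$, point $x^0$, candidate set $\mathcal{P}$, region $\Omega$, envelope $F_\gamma$ with constants $L_\gamma,\mu_\gamma$), suppose that the regularity hypothesis (R) of the context holds on $\Omega$, that $\mathcal{P}\subset\mathbb{R}^{n\times n}$ is compact and convex with $I\in\mathcal{P}$, and that $F=f+g$ has bounded sublevel sets. Run the algorithm OSOP of the context for $K\ge1$ iterations with $\beta=\max\{-\mu_\gamma,0\}$ and online stepsize $\eta=\frac{\Delta_{\mathcal{P}}}{G_\ell\sqrt{K}}$, where $G_\ell=\frac1\gamma+L_\gamma+(L_\gamma+\beta)\Delta_{\mathcal{P}}$, and let $\delta_K=\max\{-\bar\ell_K^\star-\frac{R_K}{K},0\}$. Then the iterates $x^k$ and the output $\hat x^K=q(x^K)$ satisfy: 1. If the residual PL constant satisfies $\tilde\mu_\gamma>0$, then $$F(\hat x^K)-F^\star\le(F_\gamma(x^0)-F^\star)\,(1-2\tilde\mu_\gamma\delta_K)^K.$$ 2. If $F_\gamma$ is convex on $\Omega$, then $$F(\hat x^K)-F^\star\le F_\gamma(x^K)-F^\star\le\frac{\max_{x\in\mathcal{L}_0}\operatorname{dist}(x,\mathcal{X}^\star)^2}{K\gamma^2\delta_K}.$$ 3. If $F_\gamma$ is only weakly convex on $\Omega$ (i.e. $\mu_\gamma$-convex on $\Omega$ with $\mu_\gamma$ possibly negative), then $$\min_{0\le k<K}\|\nabla F_\gamma(x^k)\|^2\le\frac{F_\gamma(x^0)-F^\star}{K\gamma^2\delta_K},\qquad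 \min_{0\le k<K}\operatorname{dist}(0,\partial F(q(x^k)))^2\le\frac{F_\gamma(x^0)-F^\star}{K\gamma^2\delta_K}.$$ (When $\delta_K=0$, right-hand sides with $\delta_K$ in the denominator are interpreted as $+\infty$.)
   Context: Standing setting: $f:\mathbb{R}^n\to\mathbb{R}$ is convex, twice differentiable and $L$-smooth ($L>0$); $g:\mathbb{R}^n\to\mathbb{R}\cup\{+\infty\}$ is proper, closed, convex; $F=f+g$; $\gamma\in(0,1/L)$. For $h$ proper closed convex, $\operatorname{prox}_{\gamma h}(z)=\arg\min_x\{h(x)+\frac1{2\gamma}\|x-z\|^2\}$ and $h_\gamma(z)=\min_x\{h(x)+\frac1{2\gamma}\|x-z\|^2\}$ (Moreau envelope). One of two cases is fixed. FB: $p(x)=x$, $q(x)=\operatorname{prox}_{\gamma g}(x-\gamma\nabla f(x))$, $F_\gamma(x)=f(x)-\frac\gamma2\|\nabla f(x)\|^2+g_\gamma(x-\gamma\nabla f(x))$. DR: $p(x)=\operatorname{prox}_{\gamma f}(x)$, $q(x)=\operatorname{prox}_{\gamma g}(2p(x)-x)$, $F_\gamma(x)=f_\gamma(x)-\gamma\|\nabla f_\gamma(x)\|^2+g_\gamma(x-2\gamma\nabla f_\gamma(x))$. In both cases $T(x)=x-(p(x)-q(x))$. $F^\star=\min F=\min F_\gamma$ and $\mathcal{X}^\star=\arg\min F_\gamma$. $\|\cdot\|$ is Euclidean/operator norm, $\|\cdot\|_F$ the Frobenius norm. ''$\ell$-smooth on a set'' means gradient $\ell$-Lipschitz there; ''$m$-convex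 on a convex set'' ($m\in\mathbb{R}$) means $h-\frac m2\|\cdot\|^2$ is convex there. $\Delta_{\mathcal{P}}=\max_{P,P'\in\mathcal{P}}\|P-P'\|_F$. Region: $\mathcal{L}_0=\{x:F_\gamma(x)\le F_\gamma(x^0)\}$ and $\Omega=\operatorname{conv}\big(\mathcal{L}_0\cup\{x-P(x-T(x)):x\in\mathcal{L}_0,P\in\mathcal{P}\}\big)$. Regularity hypothesis (R): with $0\le\mu\le L$, either (A) there are a convex set $\Omega_f$ and constants $H,D,G\ge0$ with $\mu I\preceq\nabla^2f\preceq LI$ and $\|\nabla f\|\le D$ on $\Omega_f$, $\nabla^2 f$ $H$-Lipschitz on $\Omega_f$ (operator norm), $g$ $G$-Lipschitz on $\mathbb{R}^n$, and $\Omega\subseteq\Omega_f$ (FB) or $\operatorname{prox}_{\gamma f}(\Omega)\subseteq\Omega_f$ (DR); or (B) $f$ is quadratic with Hessian $Q$, $\mu I\preceq Q\preceq LI$ (then $H(D+G)$ is replaced by $0$ below). The constants are $L_\gamma=\frac{1-\gamma\mu}{\gamma}+\gamma H(D+G)$, $\mu_\gamma=\min\{\mu(1-\gamma\mu),L(1-\gamma L)\}-\gamma H(D+G)$ in the FB case, and $L_\gamma=\frac{1-\gamma\mu}{\gamma(1+\gamma\mu)^2}+\frac{2\gamma H(D+G)}{(1+\gamma\mu)^3}$, $\mu_\gamma=\min\{\frac{\mu(1-\gamma\mu)}{(1+\gamma\mu)^2},\frac{L(1-\gamma L)}{(1+\gamma L)^2}\}-\frac{2\gamma H(D+G)}{(1+\gamma\mu)^3}$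 in the DR case. (Under (R), $F_\gamma$ is $L_\gamma$-smooth and $\mu_\gamma$-convex on $\Omega$.) Feedback: for $x\ne T(x)$, $\ell_x^\beta(P)=\frac{F_\gamma(x-P(x-T(x)))-F_\gamma(x)}{\|x-T(x)\|^2}+\frac\beta2\|P-I\|_F^2$, $P\in\mathbb{R}^{n\times n}$. Algorithm OSOP: start from $x^0$ and $P_0=I$. For $k=0,1,\dots,K-1$: stop if $x^k=T(x^k)$; set $x^{k+1/2}=x^k-P_k(x^k-T(x^k))$; set $P_{k+1}=\Pi_{\mathcal{P}}[P_k-\eta\nabla\ell_{x^k}^\beta(P_k)]$ (Frobenius projection and gradient; explicitly $\nabla\ell_{x^k}^\beta(P_k)=-\frac{\nabla F_\gamma(x^{k+1/2})(x^k-T(x^k))^\top}{\|x^k-T(x^k)\|^2}+\beta(P_k-I)$); choose $x^{k+1}\in\arg\min\{F_\gamma(x):x\in\{x^k,x^{k+1/2}\}\}$. It is understood that all $K$ iterations are carried out (no early stop). $\bar\ell_K^\star=\min_{P\in\mathcal{P}}\frac1K\sum_{k=0}^{K-1}\ell_{x^k}^\beta(P)$ and $R_K=\max_{P\in\mathcal{P}}\sum_{k=0}^{K-1}[\ell_{x^k}^\beta(P_k)-\ell_{x^k}^\beta(P)]$. The residual PL constant $\tilde\mu_\gamma$ is the largest constant such that $2\tilde\mu_\gamma(F_\gamma(x)-F^\star)\le\|x-T(x)\|^2$ for all $x\in\mathcal{L}_0$. *)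

(* Defs.v *)
From HB Require Import structures.
From mathcomp Require Import all_boot all_order all_algebra.
From mathcomp Require Import all_classical all_reals all_analysis.

Set Implicit Arguments.
Unset Strict Implicit.
Unset Printing Implicit Defensive.

Import Order.TTheory GRing.Theory Num.Theory.
Import numFieldNormedType.Exports.

Local Open Scope classical_set_scope.
Local Open Scope ring_scope.

(* The norm of the library on 'M[R]_(m, n) is the sup norm (it induces the same
   topology, hence the same notions of differentiability, compactness and
   boundedness); metric quantities below use the Frobenius norm, which is the
   Euclidean norm on column vectors. *)
Definition fnorm (R : realType) (m n : nat) (A : 'M[R]_(m, n)) : R :=
  Num.sqrt (\sum_(i < m) \sum_(j < n) A i j ^+ 2).

Definition dot (R : realType) (n : nat) (u v : 'cV[R]_n) : R :=
  \sum_(i < n) u i 0 * v i 0.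

Definition opnorm (R : realType) (n : nat) (A : 'M[R]_n) : R :=
  sup [set fnorm (A *m v) | v in [set v : 'cV[R]_n | fnorm v <= 1]].

(* Loewner order; only used between symmetric matrices. *)
Definition loewner_le (R : realType) (n : nat) (A B : 'M[R]_n) : Prop :=
  forall v : 'cV[R]_n, dot v (A *m v) <= dot v (B *m v).

(* For n = 1 this is the usual gradient on R^m; in general it is the gradient
   for the Frobenius inner product. *)
Definition grad (R : realType) (m n : nat) (h : 'M[R]_(m, n) -> R)
    (A : 'M[R]_(m, n)) : 'M[R]_(m, n) :=
  \matrix_(i < m, j < n) 'D_(delta_mx i j) h A.

Definition hess (R : realType) (n : nat) (h : 'cV[R]_n -> R)
    (x : 'cV[R]_n) : 'M[R]_n :=
  \matrix_(i < n, j < n) 'D_(delta_mx j 0) (fun y => grad h y i 0) x.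

Definition twice_differentiable (R : realType) (n : nat)
    (h : 'cV[R]_n -> R) : Prop :=
  (forall x, differentiable h x) /\ (forall x, differentiable (grad h) x).

Definition smooth (R : realType) (n : nat) (l : R) (h : 'cV[R]_n -> R) : Prop :=
  (forall x, differentiable h x) /\
  (forall x y, fnorm (grad h x - grad h y) <= l * fnorm (x - y)).

Definition m_convex_on (R : realType) (n : nat) (m : R) (A : set 'cV[R]_n)
    (h : 'cV[R]_n -> R) : Prop :=
  convex_function A (fun x => h x - m / 2 * fnorm x ^+ 2).

Definition conv_hull (R : realType) (n : nat) (A : set 'cV[R]_n) :
    set 'cV[R]_n :=
  smallest (@convex_set R 'cV[R]_n) A.

Definition proper_fun (R : realType) (n : nat) (h : 'cV[R]_n -> \bar R) : Prop :=
  (forall x, h x != -oo%E) /\ (exists x, h x != +oo%E).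

Definition closed_fun (R : realType) (n : nat) (h : 'cV[R]_n -> \bar R) : Prop :=
  closed [set xt : 'cV[R]_n * R | (h xt.1 <= xt.2%:E)%E].

Definition convex_efun (R : realType) (n : nat) (h : 'cV[R]_n -> \bar R) : Prop :=
  forall (x y : 'cV[R]_n) (t : R), 0 <= t -> t <= 1 ->
    (h (t *: x + (1 - t) *: y)%R <= t%:E * h x + (1 - t)%R%:E * h y)%E.

Definition argmin (R : realType) (T : Type) (A : set T) (h : T -> \bar R) : set T :=
  [set x | A x /\ forall y, A y -> (h x <= h y)%E].

Definition subdifferential (R : realType) (n : nat) (h : 'cV[R]_n -> \bar R)
    (x : 'cV[R]_n) : set 'cV[R]_n :=
  [set v | forall y, (h x + (dot v (y - x))%R%:E <= h y)%E].

(* The distance to the empty set is +oo. *)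
Definition set_dist (R : realType) (n : nat) (x : 'cV[R]_n) (A : set 'cV[R]_n) :
    \bar R :=
  ereal_inf [set (fnorm (x - y))%:E | y in A].

(* Quotient a / d for d >= 0, with the convention a / 0 = +oo. *)
Definition ediv (R : realType) (a : \bar R) (d : R) : \bar R :=
  if d == 0 then +oo%E else (a * (d^-1)%R%:E)%E.

(* Throughout, minima and maxima of real-valued quantities are written as infima
   and suprema; under the hypotheses in force they are finite and attained. *)

Definition prox_obj (R : realType) (n : nat) (gam : R) (h : 'cV[R]_n -> \bar R)
    (z x : 'cV[R]_n) : \bar R :=
  (h x + ((2 * gam)^-1 * fnorm (x - z) ^+ 2)%R%:E)%E.

(* For h proper closed convex and gam > 0 the set of minimizers is a singleton;
   the default value z is then irrelevant. *)
Definition prox (R : realType) (n : nat) (gam : R) (h : 'cV[R]_n -> \bar R)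
    (z : 'cV[R]_n) : 'cV[R]_n :=
  xget z (argmin setT (prox_obj gam h z)).

Definition moreau (R : realType) (n : nat) (gam : R) (h : 'cV[R]_n -> \bar R)
    (z : 'cV[R]_n) : R :=
  fine (ereal_inf (range (prox_obj gam h z))).

Inductive splitting := FB | DR.

Section splitting_defs.
Context (R : realType) (n : nat).
Variables (s : splitting) (gam : R).
Variables (f : 'cV[R]_n -> R) (g : 'cV[R]_n -> \bar R).

Definition Fsum (x : 'cV[R]_n) : \bar R := ((f x)%:E + g x)%E.

Definition Fmin : R := fine (ereal_inf (range Fsum)).

Definition pstep (x : 'cV[R]_n) : 'cV[R]_n :=
  match s with
  | FB => x
  | DR => prox gam (EFin \o f) x
  end.

Definition qstep (x : 'cV[R]_n) : 'cV[R]_n :=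
  match s with
  | FB => prox gam g (x - gam *: grad f x)
  | DR => prox gam g (2 *: pstep x - x)
  end.

Definition Tmap (x : 'cV[R]_n) : 'cV[R]_n := x - (pstep x - qstep x).

Definition envelope (x : 'cV[R]_n) : R :=
  match s with
  | FB => f x - gam / 2 * fnorm (grad f x) ^+ 2
          + moreau gam g (x - gam *: grad f x)
  | DR => let fg := moreau gam (EFin \o f) in
          fg x - gam * fnorm (grad fg x) ^+ 2
          + moreau gam g (x - (2 * gam) *: grad fg x)
  end.

Definition Xstar : set 'cV[R]_n := argmin setT (EFin \o envelope).

Definition L0set (x0 : 'cV[R]_n) : set 'cV[R]_n :=
  [set x | envelope x <= envelope x0].

Definition Omega (PP : set 'M[R]_n) (x0 : 'cV[R]_n) : set 'cV[R]_n :=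
  conv_hull (L0set x0 `|`
    [set y | exists x P, [/\ L0set x0 x, PP P & y = x - P *m (x - Tmap x)]]).

(* Alternative (A) of the regularity hypothesis; Om is the region Omega. *)
Definition regularA (mu L : R) (Om Omf : set 'cV[R]_n) (H D G : R) : Prop :=
  [/\ convex_set Omf,
      0 <= H /\ 0 <= D /\ 0 <= G,
      forall x, Omf x -> [/\ loewner_le mu%:M (hess f x),
                             loewner_le (hess f x) L%:M
                           & fnorm (grad f x) <= D],
      forall x y, Omf x -> Omf y ->
        opnorm (hess f x - hess f y) <= H * fnorm (x - y)
    & ((forall x, g x \is a fin_num) /\
       forall x y, `|fine (g x) - fine (g y)| <= G * fnorm (x - y)) /\
      match s with
      | FB => Om `<=` Omf
      | DR => prox gam (EFin \o f) @` Om `<=` Omf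
      end].

Definition regularB (mu L : R) : Prop :=
  exists (Q : 'M[R]_n) (b : 'cV[R]_n) (c : R),
    [/\ Q^T = Q,
        forall x, f x = 2^-1 * dot x (Q *m x) + dot b x + c,
        loewner_le mu%:M Q
      & loewner_le Q L%:M].

(* [hdg] is the quantity H(D+G) of alternative (A), or 0 in alternative (B). *)
Definition regularity (mu L : R) (Om : set 'cV[R]_n) (hdg : R) : Prop :=
  (exists (Omf : set 'cV[R]_n) (H D G : R),
     regularA mu L Om Omf H D G /\ hdg = H * (D + G)) \/
  (regularB mu L /\ hdg = 0).

Definition Lgam (mu hdg : R) : R :=
  match s with
  | FB => (1 - gam * mu) / gam + gam * hdg
  | DR => (1 - gam * mu) / (gam * (1 + gam * mu) ^+ 2)
          + 2 * gam * hdg / (1 + gam * mu) ^+ 3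
  end.

Definition mugam (mu L hdg : R) : R :=
  match s with
  | FB => Num.min (mu * (1 - gam * mu)) (L * (1 - gam * L)) - gam * hdg
  | DR => Num.min (mu * (1 - gam * mu) / (1 + gam * mu) ^+ 2)
                  (L * (1 - gam * L) / (1 + gam * L) ^+ 2)
          - 2 * gam * hdg / (1 + gam * mu) ^+ 3
  end.

Definition feedback (beta : R) (x : 'cV[R]_n) (P : 'M[R]_n) : R :=
  (envelope (x - P *m (x - Tmap x)) - envelope x) / fnorm (x - Tmap x) ^+ 2
  + beta / 2 * fnorm (P - 1%:M) ^+ 2.

Definition is_residual_PL (x0 : 'cV[R]_n) (m : R) : Prop :=
  forall x, L0set x0 x ->
    2 * m * (envelope x - Fmin) <= fnorm (x - Tmap x) ^+ 2.

Definition is_residual_PL_constant (x0 : 'cV[R]_n) (m : R) : Prop :=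
  is_residual_PL x0 m /\ forall m', is_residual_PL x0 m' -> m' <= m.

Definition diameter (PP : set 'M[R]_n) : R :=
  sup [set d | exists P P', [/\ PP P, PP P' & d = fnorm (P - P')]].

Definition Fproj (PP : set 'M[R]_n) (A : 'M[R]_n) : 'M[R]_n :=
  xget A (argmin PP (fun B => (fnorm (A - B))%:E)).

(* [x] and [P] are the iterates of a run of OSOP whose [K] iterations are all
   carried out: the stopping test fails for every k < K. *)
Definition OSOP_run (PP : set 'M[R]_n) (beta eta : R) (K : nat)
    (x0 : 'cV[R]_n) (x : nat -> 'cV[R]_n) (P : nat -> 'M[R]_n) : Prop :=
  [/\ x 0%N = x0, P 0%N = 1%:M
    & forall k, (k < K)%N ->
      [/\ x k <> Tmap (x k),
          P k.+1 = Fproj PP (P k - eta *: grad (feedback beta (x k)) (P k))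
        & argmin [set x k; x k - P k *m (x k - Tmap (x k))]
            (EFin \o envelope) (x k.+1)]].

Definition avg_opt (PP : set 'M[R]_n) (beta : R) (K : nat)
    (x : nat -> 'cV[R]_n) : R :=
  inf [set K%:R^-1 * \sum_(k < K) feedback beta (x k) Q | Q in PP].

Definition regret (PP : set 'M[R]_n) (beta : R) (K : nat)
    (x : nat -> 'cV[R]_n) (P : nat -> 'M[R]_n) : R :=
  sup [set \sum_(k < K) (feedback beta (x k) (P k) - feedback beta (x k) Q)
      | Q in PP].

Definition delta (PP : set 'M[R]_n) (beta : R) (K : nat)
    (x : nat -> 'cV[R]_n) (P : nat -> 'M[R]_n) : R :=
  Num.max (- avg_opt PP beta K x - regret PP beta K x P / K%:R) 0.

End splitting_defs.

(* Main.v *)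
(* In the Douglas-Rachford case the envelope, [q] and the residual at [x] are
   the forward-backward ones at [prox f x], and [prox f] is nonexpansive and
   differentiable, so one case suffices. Let [r x] be the norm of [x - T x].
   The forward step [id - gam * grad f] is nonexpansive (cocoercivity), whence
   [|grad F_gam| <= r / gam] and [dist (0, dF (q x)) <= r / gam], and the
   descent lemma gives [F (q x) <= F_gam x - c r^2] with [c > 0].
   The regret and the optimal average cancel in [delta_K], which is the positive
   part of minus the average of the feedbacks actually incurred. Hence with
   [a_k = (F_gam (x_k) - F_gam (x_{k+1})) / r (x_k)^2 >= 0] the sum of the [a_k]
   is at least [K delta_K], and the three rates are those of any sequence with
   [phi_k - phi_{k+1} = a_k r_k^2]: the AM-GM inequality under the PL condition,
   telescoping of [1 / phi_k] in the convex case, summation otherwise. *)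
Require Import Defs.
From HB Require Import structures.
From mathcomp Require Import all_boot all_order all_algebra.
From mathcomp Require Import all_classical all_reals all_analysis.
From mathcomp Require Import ring lra.

Set Implicit Arguments.
Unset Strict Implicit.
Unset Printing Implicit Defensive.

Import Order.TTheory GRing.Theory Num.Theory.
Import numFieldNormedType.Exports.

Local Open Scope classical_set_scope.
Local Open Scope ring_scope.

(** * Euclidean inner product and norm on column vectors *)

Section euclidean.
Context {R : realType} {n : nat}.
Implicit Types u v w : 'cV[R]_n.

Lemma dotC u v : dot u v = dot v u.
Proof. by apply: eq_bigr => i _; rewrite mulrC. Qed.

Lemma dotDl u v w : dot (u + v) w = dot u w + dot v w.
Proof. by rewrite -big_split; apply: eq_bigr => i _; rewrite mxE mulrDl. Qed.

Lemma dotDr u v w : dot w (u + v) = dot w u + dot w v.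
Proof. by rewrite dotC dotDl !(dotC w). Qed.

Lemma dotZl a u v : dot (a *: u) v = a * dot u v.
Proof. by rewrite /dot mulr_sumr; apply: eq_bigr => i _; rewrite mxE mulrA. Qed.

Lemma dotZr a u v : dot v (a *: u) = a * dot v u.
Proof. by rewrite dotC dotZl (dotC u). Qed.

Lemma dotNl u v : dot (- u) v = - dot u v.
Proof. by rewrite -scaleN1r dotZl mulN1r. Qed.

Lemma dotNr u v : dot v (- u) = - dot v u.
Proof. by rewrite dotC dotNl (dotC u). Qed.

Definition dotE := (dotDl, dotDr, dotNl, dotNr, dotZl, dotZr).

Lemma dot0r u : dot u 0 = 0.
Proof. by rewrite -[0](scale0r 0) dotZr mul0r. Qed.

Lemma fnorm_sqr u : fnorm u ^+ 2 = dot u u.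
Proof.
rewrite /fnorm sqr_sqrtr; last by apply: sumr_ge0 => i _; apply: sumr_ge0 => j _; rewrite sqr_ge0.
by apply: eq_bigr => i _; rewrite big_ord1 expr2.
Qed.

Lemma fnorm_ge0 m p (A : 'M[R]_(m, p)) : 0 <= fnorm A.
Proof. exact: sqrtr_ge0. Qed.

Lemma dot_ge0 u : 0 <= dot u u.
Proof. by rewrite -fnorm_sqr sqr_ge0. Qed.

Lemma fnormZ a u : fnorm (a *: u) = `|a| * fnorm u.
Proof.
apply/eqP; rewrite -(eqrXn2 (n := 2)) ?fnorm_ge0 ?mulr_ge0 ?fnorm_ge0//.
by rewrite exprMn !fnorm_sqr real_normK ?num_real// !dotE mulrA expr2.
Qed.

Lemma fnormN u : fnorm (- u) = fnorm u.
Proof. by rewrite -scaleN1r fnormZ normrN1 mul1r. Qed.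

Lemma fnormC u v : fnorm (u - v) = fnorm (v - u).
Proof. by rewrite -fnormN opprB. Qed.

Lemma norm_le_fnorm u : `|u| <= fnorm u.
Proof.
rewrite [leLHS]/Num.norm /= mx_normrE; apply/bigmax_leP; split; first exact: fnorm_ge0.
move=> [i j] _ /=; rewrite (ord1 j).
rewrite -(ler_sqr (normr_ge0 _) (fnorm_ge0 _)) fnorm_sqr real_normK ?num_real//.
rewrite /dot (bigD1 i)//= -expr2 lerDl; apply: sumr_ge0 => k _.
by rewrite -expr2 sqr_ge0.
Qed.

Lemma fnorm_le_norm u : fnorm u <= Num.sqrt n%:R * `|u|.
Proof.
rewrite -ler_sqr ?nnegrE ?fnorm_ge0 ?mulr_ge0 ?sqrtr_ge0//.
rewrite fnorm_sqr exprMn sqr_sqrtr// mulr_natl.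
have -> : `|u| ^+ 2 *+ n = \sum_(i < n) `|u| ^+ 2 by rewrite sumr_const card_ord.
apply: ler_sum => i _; rewrite -expr2 -[leLHS]real_normK ?num_real//.
rewrite ler_sqr ?nnegrE// [leRHS]/Num.norm /= mx_normrE.
by apply/bigmax_geP; right; exists (i, 0).
Qed.

Lemma fnorm_eq0 u : fnorm u = 0 -> u = 0.
Proof.
by move=> u0; apply/normr0_eq0/le_anti; rewrite normr_ge0 andbT -u0 norm_le_fnorm.
Qed.

Lemma fnorm_gt0 u : u <> 0 -> 0 < fnorm u.
Proof. by move=> u0; rewrite lt_def fnorm_ge0 andbT; apply/eqP => /fnorm_eq0. Qed.

(** Cauchy-Schwarz: the square of [fnorm v *: u - fnorm u *: v] expands to [2 * (fnorm u * fnorm v)]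
    times the difference of the two sides. *)
Lemma dot_le_fnorm u v : dot u v <= fnorm u * fnorm v.
Proof.
have [->|/eqP/fnorm_gt0 v0] := eqVneq v 0; first by rewrite dot0r mulr_ge0 ?fnorm_ge0.
have [->|/eqP/fnorm_gt0 u0] := eqVneq u 0; first by rewrite dotC dot0r mulr_ge0 ?fnorm_ge0.
have := dot_ge0 (fnorm v *: u - fnorm u *: v).
rewrite !dotE -!fnorm_sqr (dotC v u) => h.
have : 0 <= 2 * (fnorm u * fnorm v) * (fnorm u * fnorm v - dot u v) by lra.
by rewrite pmulr_rge0 ?subr_ge0// mulr_gt0// mulr_gt0.
Qed.

(** Testing with [v = u] is enough. This turns a bound on all directional derivatives into one on
    the gradient. *)
Lemma fnorm_dot_bound u (c : R) : 0 <= c ->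
  (forall v, dot u v <= c * fnorm v) -> fnorm u <= c.
Proof.
move=> c0 /(_ u); rewrite -fnorm_sqr expr2.
have [->|/eqP/fnorm_gt0 u0] := eqVneq u 0; last by rewrite ler_pM2r.
by move=> _; rewrite -[0](scale0r (0 : 'cV[R]_n)) fnormZ normr0 mul0r.
Qed.

Lemma le_fnorm_dot u v : dot u u <= dot u v -> fnorm u <= fnorm v.
Proof.
move=> h; have := le_trans h (dot_le_fnorm u v); rewrite -fnorm_sqr expr2.
have [->|/eqP/fnorm_gt0 u0] := eqVneq u 0; last by rewrite ler_pM2l.
by move=> _; rewrite -[0](scale0r (0 : 'cV[R]_n)) fnormZ normr0 mul0r fnorm_ge0.
Qed.

End euclidean.

(** * Differentiability through epsilon estimates *)

Lemma lipschitz_linear_continuous (R : realType) (V W : normedModType R)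
    (B : {linear V -> W}) (k : R) :
  (forall v, `|B v| <= k * `|v|) -> continuous B.
Proof.
move=> Bk; apply: bounded_linear_continuous.
apply/ex_bound; exists `|k|; apply/nbhs_ballP; exists 1 => //= v.
rewrite -ball_normE /= sub0r normrN => v1; apply: (le_trans (Bk v)).
apply: (@le_trans _ _ (`|k| * `|v|)); first by rewrite ler_wpM2r ?ler_norm.
by rewrite ler_piMr// ltW.
Qed.

Section epsilon_differential.
Context {R : realType} {V W : normedModType R}.

Lemma differential_eps (h : V -> W) (x : V) : differentiable h x ->
  forall e, 0 < e -> exists2 d, 0 < d & forall v, `|v| < d ->
    `|h (x + v) - h x - 'd h x v| <= e * `|v|.
Proof.
move=> /diff_locally /eqaddoP hx e e0.
have /nbhs_ballP[d d0 hd] := hx e e0.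
exists d => // v vd; have := hd v; rewrite -ball_normE /= sub0r normrN => /(_ vd).
by rewrite !fctE /= opprD addrA (addrC v).
Qed.

Lemma eps_differential (h : V -> W) (dh : {linear V -> W}) (x : V) :
  continuous dh ->
  (forall e, 0 < e -> exists2 d, 0 < d & forall v, `|v| < d ->
    `|h (x + v) - h x - dh v| <= e * `|v|) ->
  differentiable h x /\ 'd h x = dh :> (V -> W).
Proof.
move=> cdh hx.
have hxo : h \o shift x = cst (h x) + dh +o_ 0 id.
  apply/eqaddoP => e e0; have [d d0 hd] := hx e e0.
  apply/nbhs_ballP; exists d => // v; rewrite -ball_normE /= sub0r normrN => /hd.
  by rewrite !fctE /= opprD addrA (addrC v).
have dE := diff_unique cdh hxo; split => //.
by apply/diff_locallyP; rewrite dE; split.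
Qed.

End epsilon_differential.

(** * The gradient as the vector representing the differential *)

Section gradient.
Context {R : realType} {n : nat}.
Implicit Types (h : 'cV[R]_n -> R) (x u v a : 'cV[R]_n).

Lemma dot_is_linear a : linear (dot a).
Proof. by move=> k u v; rewrite dotDr dotZr. Qed.

HB.instance Definition _ a := GRing.isLinear.Build R 'cV[R]_n R _ (dot a) (dot_is_linear a).

Lemma dot_continuous a : continuous (dot a : 'cV[R]_n -> R).
Proof.
apply: (@lipschitz_linear_continuous _ _ _ _ (fnorm a * Num.sqrt n%:R)) => v.
have B w : dot a w <= fnorm a * Num.sqrt n%:R * `|w|.
  apply: (le_trans (dot_le_fnorm _ _)).
  by rewrite -mulrA ler_wpM2l ?fnorm_ge0// fnorm_le_norm.
by rewrite ler_norml lerNl -dotNr -{1}(normrN v) !B.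
Qed.

Lemma colE_sum_delta v : v = \sum_i v i 0 *: delta_mx i 0.
Proof.
apply/matrixP => i j; rewrite (ord1 j) summxE (bigD1 i)//= !mxE !eqxx mulr1.
by rewrite big1 ?addr0// => k ki; rewrite !mxE eq_sym (negbTE ki) mulr0.
Qed.

Lemma diff_gradE h x v : differentiable h x -> 'd h x v = dot (grad h x) v.
Proof.
move=> dh; rewrite [in LHS](colE_sum_delta v) linear_sum; apply: eq_bigr => i _.
by rewrite linearZ mxE deriveE// mulrC.
Qed.

Lemma grad_eps h x : differentiable h x ->
  forall e, 0 < e -> exists2 d, 0 < d & forall v, fnorm v < d ->
    `|h (x + v) - h x - dot (grad h x) v| <= e * fnorm v.
Proof.
move=> dh e e0; have [d d0 hd] := differential_eps dh e0; exists d => // v vd.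
have nv := norm_le_fnorm v.
rewrite -diff_gradE//; apply: (le_trans (hd _ _)); first exact: le_lt_trans vd.
by rewrite ler_pM2l.
Qed.

Lemma quadratic_approx_grad h x a (c : R) :
  (forall v, `|h (x + v) - h x - dot a v| <= c * fnorm v ^+ 2) ->
  differentiable h x /\ grad h x = a.
Proof.
move=> hx.
have c0 : 0 <= `|c| * n%:R by rewrite mulr_ge0.
have [dh dE] : differentiable h x /\ 'd h x = dot a :> ('cV[R]_n -> R).
  apply: eps_differential; first exact: dot_continuous.
  (* Passing from the Euclidean to the sup norm costs a factor [n] in the squared remainder; the
     [+ 1] keeps the denominator positive. *)
  move=> e e0; exists (e / (`|c| * n%:R + 1)); first by rewrite divr_gt0 ?ltr_wpDl.
  move=> v; rewrite ltr_pdivlMr ?ltr_wpDl// => ve.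
  apply: (le_trans (hx v)).
  apply: (@le_trans _ _ (`|c| * (n%:R * `|v| ^+ 2))).
    apply: (@le_trans _ _ (`|c| * fnorm v ^+ 2)).
      by rewrite ler_wpM2r ?sqr_ge0 ?ler_norm.
    rewrite ler_wpM2l// -[n%:R]sqr_sqrtr// -exprMn ler_sqr ?nnegrE ?fnorm_ge0//.
    exact: fnorm_le_norm.
  rewrite expr2 !mulrA ler_wpM2r//; have := normr_ge0 v; nra.
split => //; apply/matrixP => i j; rewrite mxE (ord1 j) deriveE// dE /dot.
rewrite (bigD1 i)//= big1 ?addr0 ?mxE ?eqxx ?mulr1// => k ki.
by rewrite mxE (negbTE ki) mulr0.
Qed.

End gradient.

(** * Convex and smooth functions *)

Section convex_smooth.
Context {R : realType} {n : nat}.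
Implicit Types (f h : 'cV[R]_n -> R) (x y u v : 'cV[R]_n) (t : R).

Lemma convex_functionE (D : set 'cV[R]_n) h x y t : convex_function D h ->
  D x -> D y -> 0 <= t -> t <= 1 ->
  h (t *: x + (1 - t) *: y) <= t * h x + (1 - t) * h y.
Proof.
move=> hD Dx Dy t0 t1.
have t01 : 0 <= t <= 1 by rewrite t0.
have := hD (Itv01 t0 t1) x y (mem_set Dx) (mem_set Dy).
by rewrite convRE.
Qed.

Lemma convex_function_line (D : set 'cV[R]_n) h x y t : convex_function D h ->
  D x -> D y -> 0 <= t -> t <= 1 ->
  h (x + t *: (y - x)) <= h x + t * (h y - h x).
Proof.
move=> hD Dx Dy t0 t1.
have -> : x + t *: (y - x) = t *: y + (1 - t) *: x.
  by rewrite scalerBr scalerBl scale1r addrCA.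
by apply: (le_trans (convex_functionE hD Dy Dx t0 t1)); lra.
Qed.

(** Divide by [t] and let [t] tend to 0: the term in [b] disappears. The input is an upper estimate
    along one ray, which both convexity and quadratic majorants provide. *)
Lemma dot_grad_le h x v (c b : R) : differentiable h x ->
  (forall t, 0 < t -> t <= 1 -> h (x + t *: v) <= h x + t * c + t ^+ 2 * b) ->
  dot (grad h x) v <= c.
Proof.
move=> dh hb; apply/ler_addgt0Pr => e e0.
pose N := fnorm v; have N0 : 0 <= N := fnorm_ge0 _.
have e2 : 0 < e / 2 / (N + 1) by rewrite !divr_gt0 ?ltr_wpDl.
have [d d0 hd] := grad_eps dh e2.
(* The three bounds keep [t] in the range of [hb], put [t *: v] in the ball of radius [d], and make
   the term in [b] at most [t * (e / 2)]; the other half of [e] absorbs the differentiability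
   error. *)
pose t := Num.min 1 (Num.min (d / 2 / (N + 1)) (e / 2 / (`|b| + 1))).
have t0 : 0 < t by rewrite !lt_min ltr01 !divr_gt0 ?ltr_wpDl.
have t1 : t <= 1 by rewrite ge_min lexx.
have td : t * (N + 1) <= d / 2.
  by rewrite -ler_pdivlMr ?ltr_wpDl// !ge_min lexx !orbT.
have tb : t * (`|b| + 1) <= e / 2.
  by rewrite -ler_pdivlMr ?ltr_wpDl// !ge_min lexx !orbT.
have Ntv : fnorm (t *: v) = t * N by rewrite fnormZ gtr0_norm.
have := hd (t *: v); rewrite Ntv => /(_ _)/wrap[]; first by nra.
rewrite ler_norml => /andP[+ _]; rewrite dotZr => h1.
have h2 := hb t t0 t1.
have h3 : e / 2 / (N + 1) * (t * N) <= t * (e / 2).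
  have -> : e / 2 / (N + 1) * (t * N) = t * (e / 2) * (N / (N + 1)) by ring.
  rewrite ler_piMr ?mulr_ge0 ?ltW// ?ltr_pdivrMr ?ltr_wpDl//; lra.
have h4 : t ^+ 2 * b <= t * (e / 2).
  rewrite expr2 -mulrA ler_pM2l//; apply: le_trans tb; rewrite ler_pM2l//.
  by have := ler_norm b; lra.
rewrite -(ler_pM2l t0); lra.
Qed.

Lemma convex_grad_le (D : set 'cV[R]_n) h x y : convex_function D h ->
  differentiable h x -> D x -> D y ->
  h x + dot (grad h x) (y - x) <= h y.
Proof.
move=> hD dh Dx Dy; rewrite -lerBrDl.
apply: (dot_grad_le (b := 0)) => // t t0 t1.
by rewrite mulr0 addr0; apply: convex_function_line => //; exact: ltW.
Qed.

(** The mean value theorem, applied to [f] along the segment minus its linear and quadratic terms,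
    replaces an integral: the derivative of [phi] is nonpositive on []0, 1[] by Cauchy-Schwarz and
    the Lipschitz bound. *)
Lemma smooth_descent L f x y : smooth L f ->
  f y <= f x + dot (grad f x) (y - x) + L / 2 * fnorm (y - x) ^+ 2.
Proof.
move=> [df Lf]; set v := y - x.
pose c := dot (grad f x) v; pose b := L / 2 * fnorm v ^+ 2.
pose line (t : R) := x + t *: v.
pose dphi (t : R) : R := dot (grad f (line t)) v - c - 2 * t * b.
pose phi : R -> R := (f \o line) - c \*: (id : R -> R) - b \*: ((id : R -> R) ^+ 2).
have phiE t : phi t = f (line t) - c * t - b * t ^+ 2 by [].
have dline (t : R) : is_diff t line ( *:%R^~ v).
  by apply: is_diff_eq; rewrite add0r; exact: erefl.
have dfline (t : R) : is_derive t 1 (f \o line) (dot (grad f (line t)) v).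
  have D : is_diff t (f \o line) ('d f (line t) \o ( *:%R^~ v)).
    by apply: is_diff_comp; apply: differentiableP.
  split; first exact/derivable1_diffP/ex_diff.
  by rewrite deriveE// diff_val /= scale1r diff_gradE.
have dphiE t : is_derive t 1 phi (dphi t).
  apply: is_derive_eq; rewrite /dphi /= expr1.
  have -> : c%:A = c by exact: mulr1.
  by rewrite -[b *: _]/(b * (2 * t * 1)); ring.
have [r] : exists2 r, r \in `]0, 1[%R & phi 1 - phi 0 = dphi r * (1 - 0).
  apply: MVT => //.
  apply: continuous_subspaceT => t; apply/differentiable_continuous/derivable1_diffP.
  exact: ex_derive.
rewrite in_itv /= => /andP[r0 r1]; rewrite !phiE /line scale1r scale0r addr0 subr0 mulr1.
rewrite addrCA subrr addr0 => h.
suff : dphi r <= 0 by rewrite -/c -/b; lra.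
have h1 := dot_le_fnorm (grad f (line r) - grad f x) v.
have := Lf (line r) x; rewrite {2}/line addrAC subrr add0r fnormZ (gtr0_norm r0) => h2.
have h3 := ler_wpM2r (fnorm_ge0 v) h2.
have -> : dphi r = dot (grad f (line r) - grad f x) v - L * (r * fnorm v) * fnorm v.
  by rewrite /dphi /b /c !dotE; field.
lra.
Qed.

(** Baillon-Haddad: the strengthened tangent inequality [key] is added to itself with the two points
    exchanged. *)
Lemma smooth_cocoercive L f x y : 0 < L -> convex_function setT f -> smooth L f ->
  fnorm (grad f x - grad f y) ^+ 2 <= L * dot (grad f x - grad f y) (x - y).
Proof.
move=> L0 cf sf.
have key u v : f u + dot (grad f u) (v - u) + fnorm (grad f v - grad f u) ^+ 2 / (2 * L) <= f v.
  (* [z] is a gradient step of length [L^-1] from [v] for [f] minus its linear part at [u]. The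
     tangent at [u] bounds [f z] below, the descent lemma from [v] bounds it above. *)
  set d := grad f v - grad f u; pose z := v - L^-1 *: d.
  have h1 : f u + dot (grad f u) (z - u) <= f z by apply: (convex_grad_le cf) => //; exact: sf.1.
  have h2 := smooth_descent v z sf.
  have zv : z - v = - (L^-1 *: d) by rewrite /z addrAC subrr add0r.
  have zu : z - u = (v - u) - L^-1 *: d by rewrite /z addrAC.
  have h3 : dot (grad f v) d - dot (grad f u) d = fnorm d ^+ 2.
    by rewrite fnorm_sqr [in RHS]/d !dotE; ring.
  clearbody d; rewrite zv fnormN fnormZ in h2; rewrite zu in h1; rewrite !dotE in h1 h2 *.
  rewrite exprMn real_normK ?num_real// in h2.
  have -> : fnorm d ^+ 2 / (2 * L) = L^-1 * fnorm d ^+ 2 - L / 2 * (L^-1 ^+ 2 * fnorm d ^+ 2).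
    by field; rewrite gt_eqF.
  have h4 : L^-1 * dot (grad f v) d - L^-1 * dot (grad f u) d = L^-1 * fnorm d ^+ 2.
    by rewrite -h3; ring.
  lra.
have h1 := key x y; have h2 := key y x.
rewrite fnormC in h1.
have h3 : fnorm (grad f x - grad f y) ^+ 2 / L <= dot (grad f x - grad f y) (x - y).
  have -> : fnorm (grad f x - grad f y) ^+ 2 / L = fnorm (grad f x - grad f y) ^+ 2 / (2 * L)
     + fnorm (grad f x - grad f y) ^+ 2 / (2 * L) by field; rewrite gt_eqF.
  rewrite !dotE in h1 h2 *; lra.
by rewrite mulrC -ler_pdivrMr.
Qed.

(** In the expanded square, cocoercivity and [gam * L < 1] bound the term [gam ^+ 2 * fnorm d ^+ 2]
    by [gam * dot d w], while the cross term subtracts twice that amount. *)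
Lemma gradient_step_nonexpansive L gam f x y : 0 < L -> 0 < gam -> gam * L < 1 ->
  convex_function setT f -> smooth L f ->
  fnorm ((x - gam *: grad f x) - (y - gam *: grad f y)) <= fnorm (x - y).
Proof.
move=> L0 g0 gL cf sf; have h := smooth_cocoercive x y L0 cf sf.
rewrite -ler_sqr ?nnegrE ?fnorm_ge0// -subr_ge0.
have -> : x - gam *: grad f x - (y - gam *: grad f y)
    = (x - y) - gam *: (grad f x - grad f y).
  by apply/matrixP => i j; rewrite !mxE; ring.
set d := grad f x - grad f y in h *; set w := x - y in h *; clearbody d w.
rewrite !fnorm_sqr !dotE -fnorm_sqr -fnorm_sqr (dotC w d).
have dw0 : 0 <= dot d w.
  by rewrite -(pmulr_rge0 _ L0); apply: le_trans h; exact: sqr_ge0.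
have h1 : gam * (gam * fnorm d ^+ 2) <= gam * (gam * L * dot d w).
  by rewrite ler_pM2l// -mulrA ler_pM2l.
have h2 : gam * (gam * L * dot d w) <= gam * dot d w.
  by rewrite ler_pM2l// ler_piMl// ltW.
have h3 : 0 <= gam * dot d w by rewrite mulr_ge0// ltW.
lra.
Qed.

End convex_smooth.

(** * Existence of minimizers *)

Section minimizers.
Context {R : realType} {n : nat}.
Implicit Types (h : 'cV[R]_n -> \bar R) (x y z : 'cV[R]_n).

Lemma norm_trmx m p (A : 'M[R]_(m, p)) : `|A^T| = `|A|.
Proof.
have le m' p' (B : 'M[R]_(m', p')) : `|B^T| <= `|B|.
  rewrite /Num.norm /= !mx_normrE; apply/bigmax_leP; split.
    by apply: bigmax_ge_id.
  by move=> [i j] _; apply/bigmax_geP; right; exists (j, i); rewrite //= mxE.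
by apply/le_anti; rewrite le /= -[in leLHS](trmxK A) le.
Qed.

Lemma trmx_continuous m p : continuous (trmx : 'M[R]_(m, p) -> 'M[R]_(p, m)).
Proof.
by apply: (@lipschitz_linear_continuous _ _ _ _ 1) => A; rewrite norm_trmx mul1r.
Qed.

(** Heine-Borel for row vectors, carried over by the transpose, an isometry for the sup norm. *)
Lemma bounded_closed_compact_cV (A : set 'cV[R]_n) :
  bounded_set A -> closed A -> compact A.
Proof.
move=> bA cA.
have -> : A = trmx @` [set u : 'rV[R]_n | A u^T].
  apply/seteqP; split=> [u Au|_ [u Au <-]//].
  by exists u^T; rewrite /= ?trmxK.
apply: continuous_compact; first exact/continuous_subspaceT/trmx_continuous.
apply: bounded_closed_compact.
  have [M [Mr MA]] := bA; exists M; split=> // N MN u /= Au.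
  by rewrite /= -norm_trmx; exact: MA.
by apply: (@preimage_closed _ _ trmx A) => // u _; exact: trmx_continuous.
Qed.

Lemma closed_sublevel h (t : R) : closed_fun h ->
  closed [set x | (h x <= t%:E)%E].
Proof.
move=> ch.
apply: (@preimage_closed _ _ (fun x => (x, t)) [set xt | (h xt.1 <= xt.2%:E)%E]) => //.
by move=> x _; apply: (@cvg_pair _ _ _ (nbhs x) (nbhs x) (nbhs t)); [exact: cvg_id|exact: cvg_cst].
Qed.

(** The nonempty sublevel sets are nested and generate a proper filter; a cluster point found in one
    compact sublevel set lies in all of them because they are closed. *)
Lemma argmin_exists h : closed_fun h -> proper_fun h ->
  (forall t : R, bounded_set [set x | (h x <= t%:E)%E]) ->
  exists x, argmin setT h x.
Proof.
move=> ch [hNy [x1 hx1]] bh.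
pose S (t : R) := [set x | (h x <= t%:E)%E].
pose D := [set t : R | exists x, (h x <= t%:E)%E].
pose t1 := fine (h x1).
have hx1E : h x1 = t1%:E by rewrite /t1 fineK// fin_numE hNy hx1.
have Dt1 : D t1 by exists x1; rewrite hx1E.
pose F := filter_from D S.
have FF : ProperFilter F.
  apply: filter_from_proper; last by move=> t [x hx]; exists x.
  apply: filter_from_filter; first by exists t1.
  move=> s t [x hx] [y hy]; exists (Num.min s t).
    by case: (leP s t) => _; [exists x|exists y].
  move=> u; rewrite /S /= => hu.
  by split => /=; apply: (le_trans hu); rewrite lee_fin ge_min lexx ?orbT.
have cS t : compact (S t).
  by apply: bounded_closed_compact_cV; [exact: bh|exact: closed_sublevel].
have [x [_ Fx]] := cS t1 F FF (ex_intro2 _ _ t1 Dt1 (fun _ H => H)).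
exists x; split=> // y _.
have [hy|hy] := eqVneq (h y) +oo%E; first by rewrite hy leey.
have [r hyE] : exists r, h y = r%:E.
  by exists (fine (h y)); rewrite fineK// fin_numE hNy hy.
have Sy : closed (S r) by exact: closed_sublevel.
rewrite hyE; apply: (Sy x) => B xB; apply: Fx => //.
by exists r => //; exists y; rewrite hyE.
Qed.

(** The epigraph of the sum is the preimage of the epigraph of [h] under a continuous shear. *)
Lemma closed_funD h (phi : 'cV[R]_n -> R) : closed_fun h -> continuous phi ->
  closed_fun (fun x => h x + (phi x)%:E)%E.
Proof.
move=> ch cphi; rewrite /closed_fun.
have -> : [set xt : 'cV[R]_n * R | (h xt.1 + (phi xt.1)%:E <= xt.2%:E)%E]
  = (fun xt : 'cV[R]_n * R => (xt.1, xt.2 - phi xt.1))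
     @^-1` [set xt | (h xt.1 <= xt.2%:E)%E].
  by apply/seteqP; split => -[x t] /=; rewrite EFinB leeBrDr.
apply: preimage_closed => // -[x t] _.
apply: (@cvg_pair _ _ _ (nbhs (x, t)) (nbhs x) (nbhs (t - phi x))).
  exact: cvg_fst.
apply: cvgB; first exact: cvg_snd.
by apply: (cvg_comp _ _ cvg_fst); exact: cphi.
Qed.

End minimizers.

(** * Subgradients, proximal maps and Moreau envelopes *)

Lemma linear_bound_le0 (R : realType) (A B : R) :
  (forall t, 0 < t -> t <= 1 -> A <= t * B) -> A <= 0.
Proof.
move=> h; apply/ler_addgt0Pr => e e0; rewrite add0r.
pose t := Num.min 1 (e / (`|B| + 1)).
have t0 : 0 < t by rewrite lt_min ltr01 divr_gt0 ?ltr_wpDl.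
apply: (le_trans (h t t0 _)); first by rewrite ge_min lexx.
have : t * (`|B| + 1) <= e by rewrite -ler_pdivlMr ?ltr_wpDl// ge_min lexx orbT.
apply: le_trans; rewrite ler_pM2l//; have := ler_norm B; lra.
Qed.

Section subdifferentials.
Context {R : realType} {n : nat}.
Variable h : 'cV[R]_n -> \bar R.
Hypothesis ph : proper_fun h.

Lemma subdifferential_fin p v : subdifferential h p v -> h p \is a fin_num.
Proof.
move=> hp; have [hNy [y hy]] := ph; rewrite fin_numE hNy /=.
by apply: contra hy => /eqP hpy; have := hp y; rewrite hpy addye// leye_eq.
Qed.

Lemma subdifferential_monotone p q v w :
  subdifferential h p v -> subdifferential h q w -> 0 <= dot (v - w) (p - q).
Proof.
move=> hp hq; have := hp q; have := hq p.
rewrite -(fineK (subdifferential_fin hp)) -(fineK (subdifferential_fin hq)).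
by rewrite -!EFinD !lee_fin !dotE; lra.
Qed.

End subdifferentials.

Section prox_theory.
Context {R : realType} {n : nat}.
Variables (gam : R) (h : 'cV[R]_n -> \bar R).
Hypotheses (gam0 : 0 < gam) (ph : proper_fun h) (ch : closed_fun h).
Hypothesis cvh : convex_efun h.
Implicit Types (x y z p v : 'cV[R]_n).

(** Monotonicity of the subdifferential, scaled by [gam]. The points are given by their inclusions
    instead of through [prox], so that uniqueness follows from the same inequality. *)
Lemma resolvent_firmly_nonexpansive z z' p p' :
  subdifferential h p (gam^-1 *: (z - p)) ->
  subdifferential h p' (gam^-1 *: (z' - p')) ->
  dot (p - p') (p - p') <= dot (p - p') (z - z').
Proof.
move=> hp hp'; have := subdifferential_monotone ph hp hp'.
rewrite -scalerBr dotZl pmulr_rge0 ?invr_gt0// (dotC (p - p') (z - z')).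
by rewrite !dotE; lra.
Qed.

Lemma resolvent_nonexpansive z z' p p' :
  subdifferential h p (gam^-1 *: (z - p)) ->
  subdifferential h p' (gam^-1 *: (z' - p')) ->
  fnorm (p - p') <= fnorm (z - z').
Proof. by move=> hp hp'; exact/le_fnorm_dot/resolvent_firmly_nonexpansive. Qed.

(** [p] is compared with the points of the segment towards [y]; after division by [t], the quadratic
    term vanishes in the limit. *)
Lemma argmin_prox_subdifferential z p : argmin setT (prox_obj gam h z) p ->
  subdifferential h p (gam^-1 *: (z - p)).
Proof.
move=> [_ pmin] y.
have [hNy [y0 hy0]] := ph.
have hfin : h p \is a fin_num.
  rewrite fin_numE hNy /=; apply/eqP => hpy.
  have := pmin y0 I; rewrite /prox_obj hpy addye// leye_eq.
  have : h y0 \is a fin_num by rewrite fin_numE hNy hy0.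
  by move=> /fineK <-.
have [hy|hy] := eqVneq (h y) +oo%E; first by rewrite hy leey.
have [r hyE] : exists r, h y = r%:E.
  by exists (fine (h y)); rewrite fineK// fin_numE hNy hy.
have [H hpE] : exists H, h p = H%:E by exists (fine (h p)); rewrite fineK.
rewrite hyE hpE -EFinD lee_fin -subr_le0 dotZl.
apply: (@linear_bound_le0 _ _ ((2 * gam)^-1 * fnorm (y - p) ^+ 2)) => t t0 t1.
have := le_trans (pmin (t *: y + (1 - t) *: p) I)
  (leeD2r _ (cvh y p (ltW t0) t1)).
rewrite /prox_obj hyE hpE -!EFinM -!EFinD lee_fin.
have -> : t *: y + (1 - t) *: p - z = t *: (y - p) - (z - p).
  by apply/matrixP => i j; rewrite !mxE; ring.
rewrite (fnormC p z) !fnorm_sqr.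
set w := y - p; set u := z - p; clearbody w u; rewrite !dotE (dotC w u) => hle.
have e2 : gam^-1 = 2 * (2 * gam)^-1 by field; rewrite gt_eqF.
rewrite -(ler_pM2l t0) e2; set b := (2 * gam)^-1 in hle *; clearbody b; lra.
Qed.

Lemma resolvent_uniq z p p' :
  subdifferential h p (gam^-1 *: (z - p)) ->
  subdifferential h p' (gam^-1 *: (z - p')) -> p = p'.
Proof.
move=> hp hp'; apply/eqP; rewrite -subr_eq0; apply/eqP/fnorm_eq0/le_anti.
rewrite fnorm_ge0 andbT; apply: le_trans (resolvent_nonexpansive hp hp') _.
by rewrite subrr -[0](scale0r (0 : 'cV[R]_n)) fnormZ normr0 mul0r.
Qed.

(* A minorant [c - a |x|^2] of [h] with [a < 1 / (2 gam)] makes the proximal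
   objective coercive. *)
Variables (a c : R).
Hypotheses (a_small : a < (2 * gam)^-1)
  (hminor : forall x, ((c - a * fnorm x ^+ 2)%:E <= h x)%E).

Lemma prox_argmin z : argmin setT (prox_obj gam h z) (prox gam h z).
Proof.
apply: (@xgetPex _ z (argmin setT (prox_obj gam h z))).
apply: argmin_exists.
- apply: closed_funD => // x.
  have [/differentiable_continuous dx _] :
     differentiable (fun x => (2 * gam)^-1 * fnorm (x - z) ^+ 2) x /\
     grad (fun x => (2 * gam)^-1 * fnorm (x - z) ^+ 2) x = gam^-1 *: (x - z).
    apply: (@quadratic_approx_grad _ _ _ _ _ (2 * gam)^-1) => v.
    have -> : x + v - z = (x - z) + v by rewrite addrAC.
    rewrite !fnorm_sqr; set w := x - z; clearbody w; rewrite !dotE (dotC v w).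
    rewrite [X in `|X|](_ : _ = (2 * gam)^-1 * dot v v); last by field; rewrite gt_eqF.
    by rewrite ger0_norm// mulr_ge0 ?dot_ge0// invr_ge0 mulr_ge0// ltW.
  exact: dx.
- have [hNy [y hy]] := ph; split=> [x|].
    by rewrite /prox_obj adde_eq_ninfty negb_or hNy.
  by exists y; rewrite /prox_obj -(fineK (x := h y)) ?fin_numE ?hNy.
- move=> t; set b := (2 * gam)^-1.
  have ab : 0 < b - a by rewrite subr_gt0.
  have b0 : 0 <= b by rewrite invr_ge0 mulr_ge0// ltW.
  (* The [+ 1] yields [1 <= fnorm x], so the constant [t - c] can be absorbed into a multiple of
     [fnorm x] and dominated, with the cross term, by [(b - a) * fnorm x ^+ 2]. *)
  pose M := (2 * b * fnorm z + `|t - c|) / (b - a) + 1.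
  exists M; split; first exact: num_real.
  move=> N MN x /= hx; apply: (le_trans (norm_le_fnorm _)).
  apply: le_trans (ltW MN); rewrite leNgt; apply/negP => Mx.
  have := le_trans (leeD2r _ (hminor x)) hx; rewrite -EFinD lee_fin -/b.
  rewrite !fnorm_sqr !dotE (dotC z x) -!fnorm_sqr => hle.
  have := dot_le_fnorm x z.
  have z2 : 0 <= b * fnorm z ^+ 2 by rewrite mulr_ge0 ?sqr_ge0.
  have x1 : 1 <= fnorm x.
    apply: le_trans (ltW Mx); rewrite lerDr divr_ge0//; last exact: ltW.
    by rewrite addr_ge0// !mulr_ge0 ?fnorm_ge0//.
  move: Mx; rewrite /M -ltrBrDr ltr_pdivrMr// => Mx cs.
  have h1 : b * dot x z <= b * (fnorm x * fnorm z) by rewrite ler_wpM2l.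
  have h2 : 0 < fnorm x * ((fnorm x - 1) * (b - a) - (2 * b * fnorm z + `|t - c|)).
    by rewrite mulr_gt0 ?subr_gt0// (lt_le_trans ltr01).
  have h3 : `|t - c| <= fnorm x * `|t - c| by rewrite ler_peMl.
  have h4 := ler_norm (t - c).
  have h5 : 0 <= fnorm x * (b - a) by rewrite mulr_ge0 ?fnorm_ge0// ltW.
  lra.
Qed.

Lemma prox_subdifferential z :
  subdifferential h (prox gam h z) (gam^-1 *: (z - prox gam h z)).
Proof. exact/argmin_prox_subdifferential/prox_argmin. Qed.

Lemma moreauE z : (moreau gam h z)%:E = prox_obj gam h z (prox gam h z).
Proof.
have [_ pmin] := prox_argmin z.
have hfin := subdifferential_fin ph (prox_subdifferential z).
rewrite /moreau; have -> : ereal_inf (range (prox_obj gam h z)) = prox_obj gam h z (prox gam h z).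
  apply/le_anti/andP; split; first by apply: ereal_inf_lbound; exists (prox gam h z).
  by apply: le_ereal_inf_tmp => _ [y _ <-]; exact: pmin.
by rewrite fineK// fin_numD hfin.
Qed.

Lemma moreau_le z x : ((moreau gam h z)%:E <= prox_obj gam h z x)%E.
Proof. by rewrite moreauE; apply: (prox_argmin z).2. Qed.

Lemma moreau_fineE z : moreau gam h z =
  fine (h (prox gam h z)) + (2 * gam)^-1 * fnorm (prox gam h z - z) ^+ 2.
Proof.
have hfin := subdifferential_fin ph (prox_subdifferential z).
by apply: EFin_inj; rewrite moreauE /prox_obj EFinD fineK.
Qed.

(** The minimizer for [z] is a competitor in the problem at [z + v]. *)
Lemma moreau_upper z v : moreau gam h (z + v) <=
  moreau gam h z + dot (gam^-1 *: (z - prox gam h z)) v + (2 * gam)^-1 * fnorm v ^+ 2.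
Proof.
have hfin := subdifferential_fin ph (prox_subdifferential z).
have := moreau_le (z + v) (prox gam h z).
rewrite /prox_obj -(fineK hfin) -EFinD lee_fin => /le_trans; apply.
rewrite moreau_fineE !fnorm_sqr; set p := prox gam h z.
have -> : p - (z + v) = - ((z - p) + v) by apply/matrixP => i j; rewrite !mxE; ring.
rewrite -(opprB z p); set w := z - p; clearbody w; rewrite !dotE (dotC v w).
have e2 : gam^-1 = 2 * (2 * gam)^-1 by field; rewrite gt_eqF.
by rewrite e2; lra.
Qed.

(** The lower estimate is [moreau_upper] read backwards from [z + v]; nonexpansiveness of [prox]
    lets the slope at [z + v] be replaced by that at [z] with a quadratic loss. *)
Lemma moreau_grad z : differentiable (moreau gam h) z /\
  grad (moreau gam h) z = gam^-1 *: (z - prox gam h z).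
Proof.
apply: (@quadratic_approx_grad _ _ _ _ _ (2 * gam)^-1) => v.
rewrite ler_norml; apply/andP; split; last by have := moreau_upper z v; lra.
have := moreau_upper (z + v) (- v); rewrite addrK fnormN.
have := resolvent_firmly_nonexpansive (prox_subdifferential (z + v)) (prox_subdifferential z).
move=> /le_fnorm_dot; rewrite addrAC subrr add0r => hpv.
set p := prox gam h z in hpv *; set p' := prox gam h (z + v) in hpv *.
have h1 : dot (p' - p) v <= fnorm v ^+ 2.
  apply: (le_trans (dot_le_fnorm _ _)).
  by rewrite expr2 ler_wpM2r ?fnorm_ge0.
have -> : z + v - p' = (z - p) + (v - (p' - p)).
  by apply/matrixP => i j; rewrite !mxE; ring.
set d := p' - p in h1 *; set w := z - p; clearbody d w.
rewrite fnorm_sqr in h1 *.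
have h2 : 0 <= gam^-1 * (dot v v - dot d v) by rewrite mulr_ge0 ?subr_ge0// invr_ge0 ltW.
by rewrite !dotE; lra.
Qed.

End prox_theory.

(** * Inverse of a coercive linear operator *)

Section coercive_operator.
Context {R : realType} {n : nat}.
Variable B : {linear 'cV[R]_n -> 'cV[R]_n}.
Hypothesis B_coercive : forall v, dot v v <= dot (B v) v.

Let M := \matrix_(i < n, j < n) B (delta_mx j 0) i 0.

Let mulM v : M *m v = B v.
Proof.
rewrite [v in RHS]colE_sum_delta linear_sum; apply/matrixP => i j.
rewrite (ord1 j) mxE summxE. apply: eq_bigr => k _.
by rewrite linearZ !mxE mulrC.
Qed.

Let unitM : M \in unitmx.
Proof.
rewrite unitmxE unitfE -det_tr; apply/negP => /det0P[v v0 Mv].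
have Bv : B v^T = 0 by rewrite -mulM -[M]trmxK -trmx_mul Mv trmx0.
have := B_coercive v^T; rewrite Bv (dotC 0) dot0r -fnorm_sqr => v2.
have /fnorm_eq0 v'0 : fnorm v^T = 0.
  by apply/eqP; rewrite -sqrf_eq0 eq_le v2 sqr_ge0.
by move: v0; rewrite -[v]trmxK v'0 trmx0 eqxx.
Qed.

(** Coercivity makes the kernel trivial, hence [B] invertible in finite dimension; coercivity at
    [C v] together with Cauchy-Schwarz then bounds the inverse. *)
Lemma coercive_inverse : exists C : {linear 'cV[R]_n -> 'cV[R]_n},
  cancel B C /\ forall v, fnorm (C v) <= fnorm v.
Proof.
exists (mulmx (invmx M)); split=> [v|v] /=; first by rewrite -mulM mulKmx.
apply: le_fnorm_dot; apply: (le_trans (B_coercive _)).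
by rewrite -mulM mulKVmx// dotC.
Qed.

End coercive_operator.

(** * Proximal map of a smooth convex function *)

Section smooth_prox.
Context {R : realType} {n : nat}.
Variables (L gam : R) (f : 'cV[R]_n -> R).
Hypotheses (L0 : 0 < L) (gam0 : 0 < gam) (cf : convex_function setT f)
  (tdf : twice_differentiable f) (sf : smooth L f).
Implicit Types (x y z p v : 'cV[R]_n).

Lemma proper_EFin : proper_fun (EFin \o f).
Proof. by split=> //; exists 0. Qed.

Lemma closed_EFin : closed_fun (EFin \o f).
Proof.
have -> : EFin \o f = (fun x => 0%:E + (f x)%:E)%E.
  by apply/funext => x; rewrite /= add0e.
apply: (@closed_funD _ _ (cst 0%:E)).
  have -> : closed_fun (cst 0%:E : 'cV[R]_n -> \bar R) =
      closed ((fun xt : 'cV[R]_n * R => xt.2) @^-1` [set t | 0 <= t]).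
    by congr closed; apply/seteqP; split=> xt /=; rewrite lee_fin.
  by apply: preimage_closed; [move=> xt _; exact: cvg_snd|exact: closed_ge].
by move=> x; exact/differentiable_continuous/sf.1.
Qed.

Lemma convex_EFin : convex_efun (EFin \o f).
Proof.
move=> x y t t0 t1; rewrite /= -!EFinM -EFinD lee_fin.
exact: (convex_functionE cf).
Qed.

(** The tangent at 0 and Young's inequality. As [e] is arbitrary, the coefficient can be put below
    the coercivity threshold [(2 * gam)^-1]. *)
Lemma convex_quadratic_minorant (e : R) : 0 < e -> exists c, forall x,
  c - e * fnorm x ^+ 2 <= f x.
Proof.
move=> e0; exists (f 0 - (4 * e)^-1 * fnorm (grad f 0) ^+ 2) => x.
have := convex_grad_le (x := 0) (y := x) cf (sf.1 _) I I; rewrite subr0.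
set u := grad f 0; apply: le_trans.
have := dot_ge0 ((2 * e)^-1 *: u + x).
rewrite !fnorm_sqr !dotE (dotC x u) => h.
have := mulr_ge0 (ltW e0) h.
have -> : e * ((2 * e)^-1 * ((2 * e)^-1 * dot u u) + (2 * e)^-1 * dot u x +
    ((2 * e)^-1 * dot u x + dot x x)) =
  (4 * e)^-1 * dot u u + dot u x + e * dot x x by field; rewrite gt_eqF.
lra.
Qed.

(** A step [t *: w] along the discrepancy [w]: the subgradient inequality against the descent lemma
    leaves [dot w w] bounded by a multiple of [t]. *)
Lemma smooth_subdifferential p v :
  subdifferential (EFin \o f) p v -> v = grad f p.
Proof.
move=> hv; apply/eqP; rewrite -subr_eq0; apply/eqP/fnorm_eq0/eqP.
rewrite -sqrf_eq0 eq_le sqr_ge0 andbT fnorm_sqr.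
set w := v - grad f p.
apply: (@linear_bound_le0 _ _ (L / 2 * fnorm w ^+ 2)) => t t0 t1.
have := hv (p + t *: w); rewrite /= -EFinD lee_fin => h1.
have h2 := smooth_descent p (p + t *: w) sf.
move: h1 h2; rewrite [p + _]addrC addrK fnormZ (gtr0_norm t0) !dotZr => h1 h2.
have -> : dot w w = dot v w - dot (grad f p) w by rewrite {1}/w !dotE.
rewrite -(ler_pM2l t0); lra.
Qed.

Let fprox := prox gam (EFin \o f).

Let minorant : exists a c : R, a < (2 * gam)^-1 /\
  forall x, ((c - a * fnorm x ^+ 2)%:E <= (EFin \o f) x)%E.
Proof.
have e0 : 0 < (4 * gam)^-1 by rewrite invr_gt0 mulr_gt0.
have [c hc] := convex_quadratic_minorant e0.
exists (4 * gam)^-1, c; split; last by move=> x; rewrite /= lee_fin.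
by rewrite ltf_pV2 ?posrE ?mulr_gt0// ltr_pM2r// ltr_nat.
Qed.

Lemma smooth_prox_subdifferential z :
  subdifferential (EFin \o f) (fprox z) (gam^-1 *: (z - fprox z)).
Proof.
have [a [c [ha hc]]] := minorant.
exact: (prox_subdifferential gam0 proper_EFin closed_EFin convex_EFin ha hc).
Qed.

Lemma smooth_prox_grad z : gam^-1 *: (z - fprox z) = grad f (fprox z).
Proof. exact/smooth_subdifferential/smooth_prox_subdifferential. Qed.

Lemma smooth_proxE z : z = fprox z + gam *: grad f (fprox z).
Proof.
by rewrite -smooth_prox_grad scalerA divff ?gt_eqF// scale1r addrC subrK.
Qed.

Lemma smooth_moreau_grad z : grad (moreau gam (EFin \o f)) z = grad f (fprox z).
Proof.
have [a [c [ha hc]]] := minorant; rewrite -smooth_prox_grad.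
by have [_ ->] := moreau_grad gam0 proper_EFin closed_EFin convex_EFin ha hc z.
Qed.

Lemma smooth_moreauE z : moreau gam (EFin \o f) z =
  f (fprox z) + gam / 2 * fnorm (grad f (fprox z)) ^+ 2.
Proof.
have [a [c [ha hc]]] := minorant.
rewrite (moreau_fineE gam0 proper_EFin closed_EFin convex_EFin ha hc) -/fprox /=.
congr (_ + _); rewrite fnormC {1}[z in z - _]smooth_proxE addrAC subrr add0r.
rewrite fnormZ exprMn real_normK ?num_real//; field; by rewrite gt_eqF.
Qed.

Lemma smooth_prox_nonexpansive y z : fnorm (fprox y - fprox z) <= fnorm (y - z).
Proof.
exact: (resolvent_nonexpansive gam0 proper_EFin
  (smooth_prox_subdifferential y) (smooth_prox_subdifferential z)).
Qed.

Lemma smooth_prox_surj y : fprox (y + gam *: grad f y) = y.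
Proof.
apply: (resolvent_uniq gam0 proper_EFin (smooth_prox_subdifferential _)).
rewrite addrAC subrr add0r scalerA mulVf ?gt_eqF// scale1r => z.
by rewrite /= -EFinD lee_fin; apply: (convex_grad_le cf) => //; exact: sf.1.
Qed.

(** An inverse function argument at one point: [fprox] inverts [id + gam *: grad f], whose
    differential [B] at [p] is coercive, so the candidate differential is [C]. Since [fprox] is
    Lipschitz, the linearization error of [grad f] in [w] is also negligible relative to [v]. *)
Lemma smooth_prox_differentiable z : differentiable fprox z.
Proof.
set p := fprox z; pose H : {linear 'cV[R]_n -> 'cV[R]_n} := 'd (grad f) p.
have dg : differentiable (grad f) p := tdf.2 p.
(* Monotonicity of the gradient, differentiated: along [v] the function [dot (- v) \o grad f] stays
   below its value at [p]. *)
have H0 v : 0 <= dot (H v) v.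
  have dphi : differentiable (dot (- v) \o grad f) p.
    apply: differentiable_comp => //.
    exact/linear_differentiable/dot_continuous.
  have : dot (grad (dot (- v) \o grad f) p) v <= 0.
    apply: (@dot_grad_le _ _ _ _ _ _ 0) => // t t0 _.
    rewrite !mulr0 !addr0 /= !dotNl lerN2 -subr_ge0.
    have h1 := convex_grad_le (x := p) (y := p + t *: v) cf (sf.1 _) I I.
    have h2 := convex_grad_le (x := p + t *: v) (y := p) cf (sf.1 _) I I.
    move: h1 h2; rewrite opprD addrA subrr add0r addrAC subrr add0r !dotE => h1 h2.
    by rewrite -(pmulr_rge0 _ t0) !(dotC v); lra.
  rewrite -diff_gradE// diff_comp//; last exact/linear_differentiable/dot_continuous.
  rewrite /= diff_lin; last exact: dot_continuous.
  by rewrite -[X in X <= 0]/(dot (- v) (H v)) dotNl oppr_le0 dotC.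
pose B : {linear 'cV[R]_n -> 'cV[R]_n} := idfun \+ gam \*: H.
have BE v : B v = v + gam *: H v by [].
have [C [BC Cle]] : exists C : {linear 'cV[R]_n -> 'cV[R]_n},
    cancel B C /\ forall v, fnorm (C v) <= fnorm v.
  apply: coercive_inverse => v.
  by rewrite BE !dotE lerDl mulr_ge0// ltW.
pose k := Num.sqrt n%:R : R.
have k0 : 0 <= k by exact: sqrtr_ge0.
have Ck v : `|C v| <= k * `|v|.
  by apply: le_trans (norm_le_fnorm _) _; apply: le_trans (Cle v) (fnorm_le_norm v).
apply: (eps_differential (lipschitz_linear_continuous Ck) _).1.
move=> e e0.
(* One factor [k] comes from the sup norm bound on [C], the other from that on [w]. *)
have den : 0 < k ^+ 2 * gam + 1 by rewrite ltr_wpDl// mulr_ge0 ?sqr_ge0// ltW.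
have [d d0 hd] := differential_eps dg (divr_gt0 e0 den).
exists (d / (k + 1)); first by rewrite divr_gt0// ltr_wpDl.
move=> v; rewrite ltr_pdivlMr ?ltr_wpDl// => vd.
pose w := fprox (z + v) - p.
have wv : `|w| <= k * `|v|.
  apply: le_trans (norm_le_fnorm _) _; apply: le_trans (fnorm_le_norm v).
  by have := smooth_prox_nonexpansive (z + v) z; rewrite addrAC subrr add0r.
have wd : `|w| < d.
  apply: le_lt_trans wv _; apply: le_lt_trans vd.
  by rewrite mulrC ler_wpM2l// lerDl.
have pw : p + w = fprox (z + v) by rewrite addrC subrK.
pose r := grad f (p + w) - grad f p - H w.
have vE : v = B w + gam *: r.
  transitivity ((p + w + gam *: grad f (p + w)) - (p + gam *: grad f p)).
    by rewrite pw -!smooth_proxE addrAC subrr add0r.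
  rewrite BE /r; move: (H w) (grad f (p + w)) => Hw gw.
  by apply/matrixP => i j; rewrite !mxE; ring.
have -> : fprox (z + v) - fprox z - C v = - (gam *: C r).
  by rewrite -/p -/w {1}vE linearD BC linearZ opprD addrA subrr add0r.
rewrite normrN normrZ (gtr0_norm gam0).
have h1 : `|C r| <= k * (e / (k ^+ 2 * gam + 1) * (k * `|v|)).
  apply: le_trans (Ck r) _; rewrite ler_wpM2l//; apply: le_trans (hd w wd) _.
  by rewrite ler_wpM2l// divr_ge0// ltW.
apply: (@le_trans _ _ (gam * (k * (e / (k ^+ 2 * gam + 1) * (k * `|v|))))).
  by rewrite ler_pM2l.
have -> : gam * (k * (e / (k ^+ 2 * gam + 1) * (k * `|v|))) =
    e * `|v| * ((k ^+ 2 * gam) / (k ^+ 2 * gam + 1)) by ring.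
rewrite ler_piMr ?mulr_ge0// ?ltW// ltr_pdivrMr// mul1r ltrDl//.
Qed.

End smooth_prox.

(** * The forward-backward envelope *)

Section splitting_theory.
Context {R : realType} {n : nat}.
Variables (L gam : R) (f : 'cV[R]_n -> R) (g : 'cV[R]_n -> \bar R).
Hypotheses (L0 : 0 < L) (gam0 : 0 < gam) (gamL : gam < 1 / L)
  (cf : convex_function setT f) (tdf : twice_differentiable f) (sf : smooth L f)
  (pg : proper_fun g) (cg : closed_fun g) (cvg : convex_efun g)
  (F_bounded : forall a : R, bounded_set [set y | (Fsum f g y <= a%:E)%E]).
Implicit Types (x y z p v : 'cV[R]_n).

Let gamL1 : gam * L < 1.
Proof. by rewrite -ltr_pdivlMr. Qed.

Lemma Fmin_attained : exists y, Fsum f g y = (Fmin f g)%:E /\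
  forall z, ((Fmin f g)%:E <= Fsum f g z)%E.
Proof.
have FE : Fsum f g = (fun x => g x + (f x)%:E)%E.
  by apply/funext => x; rewrite /Fsum addeC.
have [gNy [y1 gy1]] := pg.
have [y [_ ymin]] : exists y, argmin setT (Fsum f g) y.
  apply: argmin_exists => //.
    rewrite FE; apply: closed_funD => // x.
    exact/differentiable_continuous/sf.1.
  rewrite FE; split=> [x|]; first by rewrite adde_eq_ninfty negb_or gNy.
  by exists y1; rewrite -(fineK (x := g y1)) ?fin_numE ?gNy.
have FyE : ereal_inf (range (Fsum f g)) = Fsum f g y.
  apply/le_anti/andP; split; first by apply: ereal_inf_lbound; exists y.
  by apply: le_ereal_inf_tmp => _ [z _ <-]; exact: ymin.
have Fyfin : Fsum f g y \is a fin_num.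
  rewrite fin_numE FE adde_eq_ninfty negb_or gNy /=; apply/eqP => Fy.
  have := ymin y1 I; rewrite FE Fy leye_eq.
  by rewrite -(fineK (x := g y1)) ?fin_numE ?gNy.
by exists y; rewrite /Fmin FyE fineK//; split=> // z; exact: ymin.
Qed.

Lemma Fmin_le z : ((Fmin f g)%:E <= Fsum f g z)%E.
Proof. by have [y [_ ]] := Fmin_attained; exact. Qed.

(** [g] is at least [Fmin] minus [f], and the descent lemma at 0 bounds [f] above with quadratic
    coefficient [L / 2 < (2 * gam)^-1]. Young's inequality absorbs the linear term in half of the
    remaining room [e]. *)
Let g_minorant : exists a c : R, a < (2 * gam)^-1 /\
  forall x, ((c - a * fnorm x ^+ 2)%:E <= g x)%E.
Proof.
have LV : L < gam^-1 by rewrite -[L]invrK ltf_pV2 ?posrE ?invr_gt0// -div1r.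
pose e := (gam^-1 - L) / 2.
have e0 : 0 < e by rewrite divr_gt0// subr_gt0.
exists (L / 2 + e / 2), (Fmin f g - f 0 - (2 * e)^-1 * fnorm (grad f 0) ^+ 2).
split.
  have -> : (2 * gam)^-1 = gam^-1 / 2 by rewrite invfM mulrC.
  rewrite /e; lra.
move=> x; have h1 := smooth_descent 0 x sf; rewrite subr0 in h1.
have h2 := Fmin_le x; rewrite /Fsum addeC -leeBlDr// -EFinB in h2.
apply: le_trans h2; rewrite lee_fin.
set u := grad f 0 in h1 *; clearbody u.
have := mulr_ge0 (ltW e0) (dot_ge0 (e^-1 *: u - x)).
rewrite !dotE (dotC x u) -!fnorm_sqr.
have -> : e * (e^-1 * (e^-1 * fnorm u ^+ 2) - e^-1 * dot u x +
    - (e^-1 * dot u x - fnorm x ^+ 2)) =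
  2 * ((2 * e)^-1 * fnorm u ^+ 2 - dot u x + e / 2 * fnorm x ^+ 2).
  by field; rewrite gt_eqF.
by rewrite pmulr_rge0// => h3; lra.
Qed.

Lemma g_prox_subdifferential z :
  subdifferential g (prox gam g z) (gam^-1 *: (z - prox gam g z)).
Proof.
have [a [c [ha hc]]] := g_minorant.
exact: (prox_subdifferential gam0 pg cg cvg ha hc).
Qed.

(** Model of [f] at [x] with curvature [gam^-1]. By completing the square, the envelope at [x] is
    the minimum over [u] of this model plus [g u]. *)
Let fb_model x u := f x + dot (grad f x) (u - x) + (2 * gam)^-1 * fnorm (u - x) ^+ 2.

Let fb_modelE x u : f x - gam / 2 * fnorm (grad f x) ^+ 2
  + (2 * gam)^-1 * fnorm (u - (x - gam *: grad f x)) ^+ 2 = fb_model x u.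
Proof.
have -> : u - (x - gam *: grad f x) = (u - x) + gam *: grad f x.
  by apply/matrixP => i j; rewrite !mxE; ring.
rewrite /fb_model; set d := grad f x; set w := u - x; clearbody d w.
rewrite !fnorm_sqr !dotE (dotC w d).
by field; rewrite gt_eqF.
Qed.

Lemma envelope_FB_le x u :
  ((envelope FB gam f g x)%:E <= (fb_model x u)%:E + g u)%E.
Proof.
have [a [c [ha hc]]] := g_minorant.
rewrite -fb_modelE /envelope; move: (f x - _) => A; rewrite !EFinD -addeA leeD2l//.
by rewrite addeC; exact: (moreau_le gam0 pg cg cvg ha hc).
Qed.

Lemma envelope_FBE x (q := qstep FB gam f g x) : g q \is a fin_num /\
  envelope FB gam f g x = fb_model x q + fine (g q).
Proof.
have [a [c [ha hc]]] := g_minorant; split.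
  exact: (subdifferential_fin pg (g_prox_subdifferential _)).
rewrite -fb_modelE /envelope (moreau_fineE gam0 pg cg cvg ha hc) -/q.
by rewrite [fine _ + _]addrC addrA.
Qed.

(* Comparing the models at [x] and [y] at the same point [q x] bounds the
   increments of the envelope without differentiating [grad f]. *)
Lemma envelope_FB_upper x y : envelope FB gam f g y <= envelope FB gam f g x +
  gam^-1 * fnorm (x - qstep FB gam f g x) * fnorm (y - x) +
  (2 * gam)^-1 * fnorm (y - x) ^+ 2.
Proof.
set q := qstep FB gam f g x.
have [gq ->] := envelope_FBE x; rewrite -/q in gq *.
have h0 := envelope_FB_le y q; rewrite -(fineK gq) -EFinD lee_fin in h0.
apply: (le_trans h0); clear h0; clearbody q; rewrite /fb_model.
have h1 := convex_grad_le (x := y) (y := x) cf (sf.1 _) I I.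
(* The cross terms of the two models combine into the increment of [id - gam *: grad f] paired with
   [x - q], so nonexpansiveness controls them together. *)
have h2 := gradient_step_nonexpansive y x L0 gam0 gamL1 cf sf.
have h3 := dot_le_fnorm ((y - gam *: grad f y) - (x - gam *: grad f x)) (x - q).
have h4 := le_trans h3 (ler_wpM2r (fnorm_ge0 _) h2).
have gV : 0 < gam^-1 by rewrite invr_gt0.
have h6 : gam^-1 * dot (y - gam *: grad f y - (x - gam *: grad f x)) (x - q)
   <= gam^-1 * (fnorm (y - x) * fnorm (x - q)) by rewrite ler_pM2l.
have h8 : gam^-1 * dot (y - gam *: grad f y - (x - gam *: grad f x)) (x - q) =
  gam^-1 * dot (y - x) (x - q) - dot (grad f y - grad f x) (x - q).
  by rewrite !dotE; field; rewrite gt_eqF.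
have h9 : (2 * gam)^-1 * fnorm (q - y) ^+ 2 = (2 * gam)^-1 * fnorm (q - x) ^+ 2 +
   gam^-1 * dot (y - x) (x - q) + (2 * gam)^-1 * fnorm (y - x) ^+ 2.
  have -> : q - y = - ((x - q) + (y - x)).
    by apply/matrixP => i j; rewrite !mxE; ring.
  rewrite fnormN (fnormC q); set d := x - q; set w := y - x; clearbody d w.
  by rewrite !fnorm_sqr !dotE (dotC w d); field; rewrite gt_eqF.
have h10 : dot (grad f y) (q - y) = dot (grad f y) (x - y) + dot (grad f x) (q - x)
   - dot (grad f y - grad f x) (x - q).
  by rewrite !dotE; ring.
rewrite h8 in h6; rewrite h9 h10 -[_ * fnorm (x - q) * _]mulrA (mulrC (fnorm (x - q))).
lra.
Qed.

(** * Both splittings treated together *)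

Section any_splitting.
Variable s : splitting.
Notation p_ := (pstep s gam f).
Notation q_ := (qstep s gam f g).
Notation T_ := (Tmap s gam f g).
Notation E_ := (envelope s gam f g).

(* The Douglas-Rachford quantities at [x] are the forward-backward ones at
   [prox f x], so both cases reduce to forward-backward. *)
Lemma envelope_pstep x : E_ x = envelope FB gam f g (p_ x).
Proof.
case: s; first exact: erefl.
rewrite /envelope /=; set p := prox gam _ x.
have xE := smooth_proxE gam0 cf sf x.
rewrite (smooth_moreau_grad gam0 cf sf x) (smooth_moreauE gam0 cf sf x) -/p.
congr (_ + moreau gam g _); first by field.
rewrite {1}xE -/p; apply/matrixP => i j; rewrite !mxE; ring.
Qed.

Lemma qstep_pstep x : q_ x = qstep FB gam f g (p_ x).
Proof.
case: s; first exact: erefl.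
rewrite /qstep /=; set p := prox gam (EFin \o f) x.
congr (prox gam g _); rewrite {1}[in X in _ - X](smooth_proxE gam0 cf sf x) -/p.
by apply/matrixP => i j; rewrite !mxE; ring.
Qed.

Lemma pstep_nonexpansive x y : fnorm (p_ x - p_ y) <= fnorm (x - y).
Proof.
by case: s; [exact: lexx|exact: (smooth_prox_nonexpansive gam0 cf sf)].
Qed.

Lemma pstep_differentiable x : differentiable p_ x.
Proof.
by case: s; [exact: ex_diff|exact: (smooth_prox_differentiable gam0 cf tdf sf)].
Qed.

Lemma pstep_surj y : exists x, p_ x = y.
Proof.
case: s => /=; first by exists y.
by exists (y + gam *: grad f y); exact: (smooth_prox_surj gam0 cf sf).
Qed.

Lemma residualE x : x - T_ x = p_ x - qstep FB gam f g (p_ x).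
Proof. by rewrite /Tmap opprB addrC subrK qstep_pstep. Qed.

(** The descent lemma from [p] to [q]: the model has curvature [gam^-1] instead of [L], and the
    surplus is the residual term. *)
Lemma sufficient_decrease x :
  (Fsum f g (q_ x) + ((1 - gam * L) / (2 * gam) * fnorm (x - T_ x) ^+ 2)%:E
   <= (E_ x)%:E)%E.
Proof.
rewrite envelope_pstep residualE qstep_pstep; set p := p_ x; set q := qstep _ _ _ _ p.
have [gq ->] := envelope_FBE p; rewrite -/q.
rewrite /Fsum -(fineK gq) -!EFinD lee_fin /fb_model.
have := smooth_descent p q sf; rewrite (fnormC p q).
have -> : (1 - gam * L) / (2 * gam) = (2 * gam)^-1 - L / 2.
  by field; rewrite gt_eqF.
lra.
Qed.

Lemma Fsum_qstep_le x : (Fsum f g (q_ x) <= (E_ x)%:E)%E.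
Proof.
apply: le_trans (sufficient_decrease x); rewrite leeDl// lee_fin.
by rewrite mulr_ge0 ?sqr_ge0// divr_ge0 ?mulr_ge0 ?subr_ge0// ltW.
Qed.

Lemma Fmin_le_envelope x : Fmin f g <= E_ x.
Proof. by rewrite -lee_fin (le_trans (Fmin_le (q_ x))) ?Fsum_qstep_le. Qed.

Lemma Fmin_lt_envelope x : x <> T_ x -> Fmin f g < E_ x.
Proof.
move=> xT; rewrite -lte_fin; apply: lt_le_trans (sufficient_decrease x).
have r0 : 0 < fnorm (x - T_ x) by apply: fnorm_gt0 => /subr0_eq.
apply: (@lt_le_trans _ _ ((Fmin f g)%:E +
  ((1 - gam * L) / (2 * gam) * fnorm (x - T_ x) ^+ 2)%:E)%E).
  rewrite -EFinD lte_fin ltrDl mulr_gt0 ?exprn_gt0// divr_gt0 ?subr_gt0//.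
  by rewrite mulr_gt0.
by rewrite leeD2r// Fmin_le.
Qed.

(** A minimizer [y] of [F] equals [p_ z] for some [z], and the model at [y] taken at [u = y] is
    exactly [F y]; the envelope therefore descends to [Fmin]. *)
Lemma envelope_Xstar x : Xstar s gam f g x -> E_ x = Fmin f g.
Proof.
move=> [_ xmin]; apply/le_anti; rewrite Fmin_le_envelope andbT -lee_fin.
have [y [<- _]] := Fmin_attained; have [z zy] := pstep_surj y.
apply: (le_trans (xmin z I)); rewrite /= envelope_pstep zy.
apply: (le_trans (envelope_FB_le y y)).
by rewrite /fb_model /Fsum subrr dot0r addr0 fnorm_sqr dot0r mulr0 addr0.
Qed.

Lemma envelope_upper x y : E_ y <=
  E_ x + gam^-1 * fnorm (x - T_ x) * fnorm (y - x) + (2 * gam)^-1 * fnorm (y - x) ^+ 2.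
Proof.
have pyx := pstep_nonexpansive y x.
rewrite !envelope_pstep residualE.
apply: (le_trans (envelope_FB_upper (p_ x) (p_ y))).
apply: lerD; first rewrite lerD2l.
  by apply: ler_wpM2l => //; rewrite mulr_ge0 ?fnorm_ge0// invr_ge0 ltW.
by rewrite ler_pM2l ?invr_gt0 ?mulr_gt0// ler_sqr ?nnegrE ?fnorm_ge0.
Qed.

Lemma envelope_differentiable x : differentiable E_ x.
Proof.
have -> : E_ = envelope FB gam f g \o p_.
  by apply/funext => y; exact: envelope_pstep.
apply: differentiable_comp; first exact: pstep_differentiable.
have [a [c [ha hc]]] := g_minorant; have [df dg] := tdf.
move: (p_ x) => y.
have dn (u : 'cV[R]_n) : differentiable (fun u : 'cV[R]_n => fnorm u ^+ 2) u.
  apply: (@quadratic_approx_grad _ _ _ _ (2 *: u) 1 _).1 => v.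
  rewrite !fnorm_sqr !dotE (dotC v u) [X in `|X|](_ : _ = dot v v); last by ring.
  by rewrite ger0_norm ?dot_ge0// mul1r.
have d1 : differentiable (f - (gam / 2) *: ((fun u => fnorm u ^+ 2) \o grad f)) y.
  by apply: differentiableB => //; apply/differentiableZ/differentiable_comp.
have d2 : differentiable (id - gam *: grad f) y.
  by apply: differentiableB => //; apply: differentiableZ.
exact: differentiableD d1 (differentiable_comp d2
  (moreau_grad gam0 pg cg cvg ha hc _).1).
Qed.

Lemma dot_grad_envelope_le x v :
  dot (grad E_ x) v <= gam^-1 * fnorm (x - T_ x) * fnorm v.
Proof.
apply: (@dot_grad_le _ _ _ _ _ _ ((2 * gam)^-1 * fnorm v ^+ 2)).
  exact: envelope_differentiable.
move=> t t0 t1; apply: (le_trans (envelope_upper x _)).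
have -> : x + t *: v - x = t *: v by rewrite addrAC subrr add0r.
by rewrite fnormZ (gtr0_norm t0); lra.
Qed.

Lemma fnorm_grad_envelope_le x : fnorm (grad E_ x) <= gam^-1 * fnorm (x - T_ x).
Proof.
apply: fnorm_dot_bound (dot_grad_envelope_le x).
by rewrite mulr_ge0 ?fnorm_ge0// invr_ge0 ltW.
Qed.

Lemma convex_envelope_gap (D : set 'cV[R]_n) x y : convex_function D E_ ->
  D x -> D y -> Xstar s gam f g y ->
  E_ x - Fmin f g <= gam^-1 * fnorm (x - T_ x) * fnorm (x - y).
Proof.
move=> cE Dx Dy /envelope_Xstar Ey.
have := convex_grad_le cE (envelope_differentiable x) Dx Dy.
rewrite Ey -(opprB x y) dotNr lerBlDr -lerBlDl => /le_trans; apply.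
exact: dot_grad_envelope_le.
Qed.

(** Optimality of [q] puts [gam^-1 *: (W p - q)] in the subdifferential of [g] at [q]; adding
    [grad f q] gives [gam^-1 *: (W p - W q)], which the nonexpansive forward step bounds. *)
Lemma residual_subdifferential x : exists2 v,
  subdifferential (Fsum f g) (q_ x) v & fnorm v <= gam^-1 * fnorm (x - T_ x).
Proof.
rewrite residualE qstep_pstep; set p := p_ x; set q := qstep _ _ _ _ p.
pose W z := z - gam *: grad f z.
exists (gam^-1 *: (W p - W q)); last first.
  rewrite fnormZ gtr0_norm ?invr_gt0// ler_pM2l ?invr_gt0//.
  exact: (gradient_step_nonexpansive p q L0 gam0 gamL1 cf sf).
move=> y; have hg := g_prox_subdifferential (W p) y.
rewrite -/(qstep FB gam f g p) -/q in hg.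
have gq : g q \is a fin_num := (envelope_FBE p).1.
have hf := convex_grad_le (x := q) (y := y) cf (sf.1 _) I I.
apply: le_trans (leeD2l (f y)%:E hg).
rewrite /Fsum -(fineK gq) -!EFinD lee_fin.
have -> : gam^-1 *: (W p - W q) = gam^-1 *: (W p - q) + grad f q.
  rewrite [W q]/W opprB addrCA addrC scalerDr scalerA mulVf ?gt_eqF// scale1r.
  by [].
rewrite dotDl; lra.
Qed.

Lemma set_dist_subdifferential_le x :
  (set_dist 0 (subdifferential (Fsum f g) (q_ x)) <= (gam^-1 * fnorm (x - T_ x))%:E)%E.
Proof.
have [v vF hv] := residual_subdifferential x.
apply: ereal_inf_le; exists (fnorm v)%:E; last by rewrite lee_fin.
by exists v => //; rewrite sub0r fnormN.
Qed.

End any_splitting.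
End splitting_theory.

(** * Rates for abstract descent sequences *)

Section descent_sequences.
Context {R : realType}.
Variables (phi a rho : nat -> R) (K : nat) (d : R).
Hypotheses (K0 : (0 < K)%N) (d0 : 0 <= d) (a_sum : K%:R * d <= \sum_(k < K) a k).
Hypothesis a0 : forall k, (k < K)%N -> 0 <= a k.
Hypothesis rho0 : forall k, (k < K)%N -> 0 <= rho k.
Hypothesis phi_step : forall k, (k < K)%N -> phi k - phi k.+1 = a k * rho k.

(** Each step contracts by [1 - c * a k]; AM-GM bounds the product of these factors by a power of
    their mean, which sees only the sum of the [a k]. *)
Lemma linear_descent (c : R) : 0 <= c -> 0 <= phi K ->
  (forall k, (k < K)%N -> 0 < phi k /\ c * phi k <= rho k) ->
  phi K <= phi 0%N * (1 - c * d) ^+ K.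
Proof.
move=> c0 phiK h.
have phi_le k : (k < K)%N -> phi k.+1 <= phi k * (1 - c * a k).
  move=> kK; have [_ hr] := h k kK; have := ler_wpM2l (a0 kK) hr.
  by rewrite -(phi_step kK); lra.
have phi_ge0 k : (k <= K)%N -> 0 <= phi k.
  by rewrite leq_eqVlt => /orP[/eqP->//|/h[/ltW]].
(* AM-GM needs nonnegative factors: a negative one would make [phi k.+1] negative. *)
have q0 k : (k < K)%N -> 0 <= 1 - c * a k.
  move=> kK; have [p0 _] := h k kK; rewrite -(pmulr_rge0 _ p0).
  by apply: le_trans (phi_le k kK); exact: phi_ge0.
have prod_le m : (m <= K)%N -> phi m <= phi 0%N * \prod_(k < m) (1 - c * a k).
  elim: m => [_|m IH mK]; first by rewrite big_ord0 mulr1.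
  rewrite big_ord_recr /= mulrA; apply: (le_trans (phi_le m mK)).
  by rewrite ler_wpM2r ?q0// IH// ltnW.
apply: (le_trans (prod_le K (leqnn K))); rewrite ler_wpM2l ?phi_ge0//.
have := leif_AGM (A := predT) (E := fun k : 'I_K => 1 - c * a k) (fun k _ => q0 k (ltn_ord k)).
move=> /leifP; rewrite cardT size_enum_ord.
have K0' : 0 < K%:R :> R by rewrite ltr0n.
set S := (\sum_(i in _) _) / _ => hS.
have S_le : S <= 1 - c * d.
  rewrite /S ler_pdivrMr// big_split /= sumr_const sumrN -mulr_sumr card_ord.
  have := ler_wpM2l c0 a_sum; lra.
have S0 : 0 <= S.
  apply: divr_ge0; last exact: ltW.
  by apply: sumr_ge0 => k _; exact: q0.
apply: (@le_trans _ _ (S ^+ K)); last by rewrite lerXn2r ?nnegrE ?(le_trans S0).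
by move: hS; case: ifP => _ => [/eqP->|/ltW].
Qed.

Lemma sum_descent_le : 0 <= phi K -> \sum_(k < K) a k * rho k <= phi 0%N.
Proof.
move=> phiK; have -> : \sum_(k < K) a k * rho k = phi 0%N - phi K; last by lra.
rewrite -opprB -(telescope_sumr phi (leq0n K)) -sumrN big_mkord.
by apply: eq_bigr => k _; rewrite -phi_step// opprB.
Qed.

(** The smallest [rho k] is pulled out of the sum of [a k * rho k], which telescopes. *)
Lemma min_residual : 0 < d -> 0 <= phi K ->
  exists k : 'I_K, rho k <= phi 0%N / (K%:R * d).
Proof.
move=> dp phiK; pose i0 := Ordinal K0.
case: (@Order.TotalTheory.arg_minP _ _ 'I_K i0 predT (fun k => rho k) isT) => k _ kmin.
exists k; rewrite ler_pdivlMr ?mulr_gt0 ?ltr0n//.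
apply: le_trans (sum_descent_le phiK).
apply: (@le_trans _ _ (rho k * \sum_(i < K) a i)).
  by apply: ler_wpM2l => //; exact: rho0.
rewrite mulr_sumr; apply: ler_sum => i _; rewrite mulrC.
by apply: ler_wpM2l; [exact: a0|exact: kmin].
Qed.

(** The telescoping of [1 / phi] in product form, since [phi K] may vanish: the invariant is that
    [phi m] times the partial sum of the [a k] stays below [D]. *)
Lemma sublinear_descent (D : R) : 0 <= phi K ->
  (forall k, (k < K)%N -> 0 < phi k /\ phi k ^+ 2 <= rho k * D) ->
  phi K * (K%:R * d) <= D.
Proof.
move=> phiK h.
have phi_ge0 k : (k <= K)%N -> 0 <= phi k.
  by rewrite leq_eqVlt => /orP[/eqP->//|/h[/ltW]].
have D0 : 0 < D.
  have [p0 hp] := h 0%N K0; have rD := lt_le_trans (exprn_gt0 2 p0) hp.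
  have r0 : 0 < rho 0%N.
    rewrite lt_def rho0// andbT; apply/eqP => r0.
    by move: rD; rewrite r0 mul0r ltxx.
  by rewrite -(pmulr_rgt0 _ r0).
apply: (@le_trans _ _ (phi K * \sum_(k < K) a k)); first exact: ler_wpM2l.
suff main m : (m <= K)%N -> phi m * \sum_(k < m) a k <= D by exact: main.
elim: m => [_|m IH mK]; first by rewrite big_ord0 mulr0 ltW.
rewrite big_ord_recr /=; have [p0 hp] := h m mK; have am := a0 mK.
set S := \sum_(k < m) _ in IH *.
have {}IH : phi m * S <= D by exact/IH/ltnW.
have S0 : 0 <= S by apply: sumr_ge0 => k _; apply: a0; exact: (ltn_trans (ltn_ord k)).
(* [w] bounds the relative decrease from below, and the invariant survives because
   [(1 - w) * (1 + w) <= 1]. *)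
pose w := a m * phi m / D.
have w0 : 0 <= w by rewrite divr_ge0 ?mulr_ge0// ltW.
have wD : phi m * a m = w * D by rewrite /w divfK ?gt_eqF// mulrC.
have phi_le : phi m.+1 <= phi m * (1 - w).
  have : phi m * w <= a m * rho m.
    rewrite /w mulrA ler_pdivrMr// mulrCA -mulrA ler_wpM2l//.
  by have := phi_step mK; lra.
have w1 : 0 <= 1 - w.
  by rewrite -(pmulr_rge0 _ p0); apply: le_trans phi_le; exact: phi_ge0.
apply: (@le_trans _ _ (phi m * (1 - w) * (S + a m))).
  by rewrite ler_wpM2r// addr_ge0.
have -> : phi m * (1 - w) * (S + a m) = (1 - w) * (phi m * S + w * D).
  by rewrite -wD; ring.
apply: (@le_trans _ _ ((1 - w) * (D + w * D))); first by rewrite ler_wpM2l// lerD2r.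
have : 0 <= w ^+ 2 * D by rewrite mulr_ge0 ?sqr_ge0// ltW.
lra.
Qed.

End descent_sequences.

(** * Feedback, regret and [delta] *)

Section feedback_average.
Context {R : realType} {n : nat}.
Variables (s : splitting) (gam : R) (f : 'cV[R]_n -> R) (g : 'cV[R]_n -> \bar R).
Variables (m : R) (beta : R).
Hypotheses (env_ge : forall y, m <= envelope s gam f g y) (beta0 : 0 <= beta).
Implicit Types (x : 'cV[R]_n) (P : 'M[R]_n) (PP : set 'M[R]_n).

Lemma feedback_ge x P :
  (envelope s gam f g (x - P *m (x - Tmap s gam f g x)) - envelope s gam f g x)
    / fnorm (x - Tmap s gam f g x) ^+ 2 <= feedback s gam f g beta x P.
Proof. by rewrite lerDl mulr_ge0 ?sqr_ge0// divr_ge0. Qed.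

(** The bound is uniform in [P], so the set defining the regret is bounded above and its [sup] is a
    genuine supremum. *)
Lemma feedback_lower_bound x P :
  (m - envelope s gam f g x) / fnorm (x - Tmap s gam f g x) ^+ 2
    <= feedback s gam f g beta x P.
Proof.
apply: le_trans (feedback_ge x P).
by rewrite ler_wpM2r ?invr_ge0 ?sqr_ge0// lerB.
Qed.

(* Regret and optimal average cancel: [delta] is the positive part of the
   average decrease predicted by the feedbacks actually incurred. *)
Lemma delta_le_average PP K (x : nat -> 'cV[R]_n) (P : nat -> 'M[R]_n) (B : R) :
  (0 < K)%N -> PP !=set0 -> 0 <= B ->
  - \sum_(k < K) feedback s gam f g beta (x k) (P k) <= B ->
  K%:R * delta s gam f g PP beta K x P <= B.
Proof.
move=> K0 [Q0 PQ0] B0 hB; have K0' : 0 < K%:R :> R by rewrite ltr0n.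
set S := \sum_(k < K) _ in hB.
rewrite /delta maxr_pMr ?(ltW K0')// mulr0 ge_max B0 andbT; apply: le_trans hB.
set r := regret _ _ _ _ _ _ _ _ _.
(* For each fixed [Q], [S] minus the total feedback of [Q] is at most the regret [r]; the infimum
   over [Q] gives this bound. *)
suff : (S - r) / K%:R <= avg_opt s gam f g PP beta K x.
  rewrite ler_pdivrMr//; set A := avg_opt _ _ _ _ _ _ _ _ => h.
  have -> : K%:R * (- A - r / K%:R) = - (A * K%:R) - r by field; rewrite gt_eqF.
  lra.
apply: lb_le_inf.
  by exists (K%:R^-1 * \sum_(k < K) feedback s gam f g beta (x k) Q0); exists Q0.
move=> _ [Q PQ <-]; rewrite mulrC ler_pM2l ?invr_gt0// lerBlDr -lerBlDl.
rewrite /S -sumrB; apply: ub_le_sup; last by exists Q.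
exists (\sum_(k < K) (feedback s gam f g beta (x k) (P k) -
  (m - envelope s gam f g (x k)) / fnorm (x k - Tmap s gam f g (x k)) ^+ 2)).
move=> _ [Q' _ <-]; apply: ler_sum => k _.
by rewrite lerB// feedback_lower_bound.
Qed.

End feedback_average.

(** * Convergence rates of OSOP *)

Theorem theorem4p19 (R : realType) (n : nat) (s : splitting)
    (L gam mu hdg : R)
    (f : 'cV[R]_n -> R) (g : 'cV[R]_n -> \bar R)
    (PP : set 'M[R]_n) (x0 : 'cV[R]_n) (K : nat)
    (x : nat -> 'cV[R]_n) (P : nat -> 'M[R]_n)
    (hL : 0 < L) (hgam : 0 < gam) (hgamL : gam < 1 / L)
    (hmu : 0 <= mu) (hmuL : mu <= L)
    (hf_convex : convex_function setT f)
    (hf_diff : twice_differentiable f)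
    (hf_smooth : smooth L f)
    (hg_proper : proper_fun g) (hg_closed : closed_fun g)
    (hg_convex : convex_efun g)
    (hPP_compact : compact PP) (hPP_convex : convex_set PP)
    (hPP_id : PP 1%:M)
    (hreg : regularity s gam f g mu L (Omega s gam f g PP x0) hdg)
    (hF_bounded : forall a : R, bounded_set [set y | (Fsum f g y <= a%:E)%E])
    (hK : (1 <= K)%N) :
  let Lg := Lgam s gam mu hdg in
  let mug := mugam s gam mu L hdg in
  let Fg := envelope s gam f g in
  let F := Fsum f g in
  let Fstar := Fmin f g in
  let q := qstep s gam f g in
  let Om := Omega s gam f g PP x0 in
  let L0 := L0set s gam f g x0 in
  let beta : R := Num.max (- mug) 0 in
  let Dl := diameter PP in
  let Gl := 1 / gam + Lg + (Lg + beta) * Dl in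
  let eta := Dl / (Gl * Num.sqrt K%:R) in
  let dK := delta s gam f g PP beta K x P in
  OSOP_run s gam f g PP beta eta K x0 x P ->
  [/\ forall mut : R,
        is_residual_PL_constant s gam f g x0 mut -> 0 < mut ->
        (F (q (x K)) - Fstar%:E <=
           ((Fg x0 - Fstar) * (1 - 2 * mut * dK) ^+ K)%R%:E)%E,
      convex_function Om Fg ->
        (F (q (x K)) - Fstar%:E <= (Fg (x K) - Fstar)%R%:E)%E /\
        ((Fg (x K) - Fstar)%R%:E <=
           ediv (ereal_sup [set set_dist y (Xstar s gam f g) ^+ 2 | y in L0])
                (K%:R * gam ^+ 2 * dK)%R)%E
    & m_convex_on mug Om Fg ->
        (\big[mine/+oo]_(k < K) (fnorm (grad Fg (x k)) ^+ 2)%R%:E <=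
           ediv (Fg x0 - Fstar)%R%:E (K%:R * gam ^+ 2 * dK)%R)%E /\
        (\big[mine/+oo]_(k < K)
            (set_dist 0 (subdifferential F (q (x k))) ^+ 2) <=
           ediv (Fg x0 - Fstar)%R%:E (K%:R * gam ^+ 2 * dK)%R)%E].
Proof.
move=> Lg mug Fg F Fstar q Om L0 beta Dl Gl eta dK [x_0 P_0 run].
pose T := Tmap s gam f g; pose r y := fnorm (y - T y).
have beta0 : 0 <= beta by rewrite le_max lexx orbT.
have Fg_ge y : Fstar <= Fg y.
  exact: (Fmin_le_envelope hL hgam hgamL hf_convex hf_smooth hg_proper hg_closed
      hg_convex hF_bounded).
have Fq_le y : (F (q y) - Fstar%:E <= (Fg y - Fstar)%:E)%E.
  rewrite EFinB leeD2r//.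
  exact: (Fsum_qstep_le hL hgam hgamL hf_convex hf_smooth hg_proper hg_closed
      hg_convex hF_bounded).
have Xstar_val y : Xstar s gam f g y -> Fg y = Fstar.
  exact: (envelope_Xstar hL hgam hgamL hf_convex hf_smooth hg_proper hg_closed
      hg_convex hF_bounded).
pose phi k := Fg (x k) - Fstar.
pose rho k := r (x k) ^+ 2.
pose a k := (Fg (x k) - Fg (x k.+1)) / rho k.
have phi_ge0 k : 0 <= phi k by rewrite subr_ge0.
have rho_gt0 k : (k < K)%N -> 0 < rho k.
  move=> /run[xT _ _]; rewrite exprn_gt0//; apply: fnorm_gt0 => /subr0_eq.
  exact: xT.
have phi_gt0 k : (k < K)%N -> 0 < phi k.
  move=> /run[xT _ _]; rewrite subr_gt0.
  exact: (Fmin_lt_envelope hL hgam hgamL hf_convex hf_smooth hg_proper hg_closed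
      hg_convex hF_bounded).
have descent k : (k < K)%N -> Fg (x k.+1) <= Fg (x k).
  move=> /run[_ _ [_ xmin]].
  by have := xmin (x k) (or_introl (erefl _)); rewrite lee_fin.
have a_ge0 k : (k < K)%N -> 0 <= a k.
  by move=> kK; rewrite divr_ge0 ?sqr_ge0// subr_ge0 descent.
have phi_step k : (k < K)%N -> phi k - phi k.+1 = a k * rho k.
  by move=> kK; rewrite /a divfK ?gt_eqF ?rho_gt0// /phi opprB addrA subrK.
(* The penalty in the feedback is nonnegative and [x k.+1] is no worse than the half step, so [a k]
   dominates the negated feedback; nonnegativity of the [a k] covers the truncation of [dK] at 0. *)
have a_sum : K%:R * dK <= \sum_(k < K) a k.
  apply: (delta_le_average Fg_ge beta0) => //; first by exists 1%:M.
    by apply: sumr_ge0 => k _; exact: a_ge0.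
  rewrite -sumrN; apply: ler_sum => k _.
  have [_ _ [_ xmin]] := run k (ltn_ord k).
  have := xmin _ (or_intror (erefl _)); rewrite lee_fin => xhalf.
  have h := feedback_ge s gam f g beta0 (x k) (P k); rewrite -lerN2 in h.
  apply: (le_trans h); rewrite -mulNr opprB; apply: ler_wpM2r.
    by rewrite invr_ge0; exact: sqr_ge0.
  by apply: lerB; [exact: lexx|exact: xhalf].
have dK0 : 0 <= dK by rewrite le_max lexx orbT.
have x_L0 k : (k <= K)%N -> L0 (x k).
  elim: k => [|k IH] kK; first by rewrite x_0 /L0 /L0set /= lexx.
  apply: le_trans (IH (ltnW kK)); exact: descent.
have rho_ge0 k : (k < K)%N -> 0 <= rho k by move=> /rho_gt0/ltW.
have gamV : 0 < gam^-1 by rewrite invr_gt0.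
have K0 : 0 < K%:R :> R by rewrite ltr0n.
split.
- move=> mut [PL _] mut0; apply: (le_trans (Fq_le _)); rewrite lee_fin -x_0.
  have := linear_descent hK a_sum a_ge0 phi_step (c := 2 * mut).
  apply => //; first by rewrite mulr_ge0// ltW.
  by move=> k kK; split; [exact: phi_gt0|exact: PL (x_L0 k (ltnW kK))].
- move=> cE; split; first exact: Fq_le.
  rewrite /ediv; case: eqP => [_|/eqP dn0]; first exact: leey.
  set D : \bar R := ereal_sup _.
  have L0Om y : L0 y -> Om y by move=> yL; apply: sub_gen_smallest; left.
  (* Minimizers lie in [L0], hence in [Om], where the tangent inequality bounds the gap by residual
     times distance. If there is no minimizer the distance is [+oo]. *)
  have D_ge k : (k < K)%N -> (((phi k * (gam / r (x k))) ^+ 2)%R%:E <= D)%E.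
    move=> kK; have kL0 := x_L0 k (ltnW kK).
    have r0 : 0 < r (x k).
      by have := rho_gt0 k kK; rewrite /rho exprn_even_gt0//= lt_def fnorm_ge0 andbT.
    have le_dist : ((phi k * (gam / r (x k)))%:E <= set_dist (x k) (Xstar s gam f g))%E.
      apply: le_ereal_inf_tmp => _ [y yX <-]; rewrite lee_fin.
      have yL0 : L0 y by have := Fg_ge x0; rewrite -(Xstar_val _ yX).
      have := convex_envelope_gap hL hgam hgamL hf_convex hf_diff hf_smooth hg_proper hg_closed
      hg_convex hF_bounded cE
        (L0Om _ kL0) (L0Om _ yL0) yX.
      rewrite -/T -/(r (x k)) -/(phi k) => gap.
      rewrite mulrA ler_pdivrMr// -ler_pdivlMr//.
      by rewrite mulrC (mulrC (fnorm _) (r _)) mulrA.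
    apply: le_ereal_sup_tmp; exists (set_dist (x k) (Xstar s gam f g) ^+ 2)%E.
      by exists (x k).
    have lhs0 : (0 <= (phi k * (gam / r (x k)))%:E)%E.
      by rewrite lee_fin mulr_ge0// divr_ge0// ltW.
    by rewrite EFin_expe lee_sqr// (le_trans lhs0).
  have Kg0 : 0 < K%:R * gam ^+ 2 * dK.
    by rewrite !mulr_gt0 ?exprn_gt0// lt_def dK0 andbT; apply: contra dn0 => /eqP->; rewrite mulr0.
  have D0 : (0 <= D)%E by apply: le_trans (D_ge 0%N hK); rewrite lee_fin sqr_ge0.
  move: D0 D_ge; case: D => [D| |] // D0 D_ge; last by rewrite gt0_mulye ?leey// lte_fin invr_gt0.
  rewrite -EFinM lee_fin ler_pdivlMr//.
  (* Squaring [phi k * gam / r (x k)] in [D_ge] gives [phi k ^+ 2 <= rho k * (D / gam ^+ 2)]. *)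
  have := sublinear_descent hK a_sum a_ge0 rho_ge0 phi_step (D := D / gam ^+ 2).
  rewrite ler_pdivlMr ?exprn_gt0// => main.
  rewrite -/(phi K).
  have -> : phi K * (K%:R * gam ^+ 2 * dK) = phi K * (K%:R * dK) * gam ^+ 2 by ring.
  apply: main => // k kK; split; first exact: phi_gt0.
  rewrite mulrA ler_pdivlMr ?exprn_gt0// -ler_pdivrMl ?rho_gt0//.
  have := D_ge k kK; rewrite lee_fin; apply: le_trans.
  by rewrite /rho !exprMn exprVn mulrC mulrA.
- move=> _; rewrite /ediv; case: eqP => [_|/eqP dn0]; first by split; exact: leey.
  have dK_gt0 : 0 < dK.
    by rewrite lt_def dK0 andbT; apply: contra dn0 => /eqP->; rewrite mulr0.
  (* One index [k] of smallest residual bounds both minima, since the gradient and the distance to 0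
     of the subdifferential are each at most [gam^-1 * r (x k)]. *)
  have [k hk] := min_residual hK a_sum a_ge0 rho_ge0 phi_step dK_gt0 (phi_ge0 K).
  have bound : (gam^-1 * r (x k)) ^+ 2 <= (Fg x0 - Fstar) / (K%:R * gam ^+ 2 * dK).
    rewrite exprMn exprVn.
    have -> : (Fg x0 - Fstar) / (K%:R * gam ^+ 2 * dK) = (gam ^+ 2)^-1 * (phi 0%N / (K%:R * dK)).
      by rewrite /phi x_0; field; rewrite !gt_eqF.
    by rewrite ler_wpM2l// invr_ge0 sqr_ge0.
  split; (apply: (bigmin_inf k) => //).
    rewrite -EFinM lee_fin; apply: le_trans bound.
    rewrite ler_sqr ?nnegrE ?fnorm_ge0//; last by rewrite mulr_ge0 ?fnorm_ge0// ltW.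
    exact: (fnorm_grad_envelope_le hL hgam hgamL hf_convex hf_diff hf_smooth hg_proper hg_closed
      hg_convex hF_bounded).
  have hd := set_dist_subdifferential_le hL hgam hgamL hf_convex hf_smooth hg_proper hg_closed
      hg_convex hF_bounded s (x k).
  have d0 : (0 <= set_dist 0 (subdifferential (Fsum f g) (qstep s gam f g (x k))))%E.
    by apply: le_ereal_inf_tmp => _ [y _ <-]; rewrite lee_fin fnorm_ge0.
  rewrite -EFinM; apply: (@le_trans _ _ ((gam^-1 * r (x k))%:E ^+ 2)%E).
    by rewrite lee_sqr// (le_trans d0).
  by rewrite -EFin_expe lee_fin.
Qed.
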